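(* Let $\mathbb K$ be a field of characteristic different from $2$. The symplectic-orthogonal supergroup $SpO(2|1)$ over any supercommutative superalgebra $A=A_0\oplus A_1$ admits a cluster superalgebra structure. That is: there is an initial seed $(X|Y,Q)$ such that the cluster superalgebra $\mathcal C_{\mathbb K}(X|Y,Q)$ is isomorphic to the coordinate superalgebra of $SpO(2|1)$, i.e. such that, naturally in the supercommutative $\mathbb K$-superalgebra $A$, the set $SpO(2|1)(A)$ is in bijection with the set of (parity-preserving, unital) superalgebra homomorphisms $\mathcal C_{\mathbb K}(X|Y,Q)\to A$.
   Context: **Superalgebras.** A superalgebra $A=A_0\oplus A_1$ is a $\mathbb Z_2$-graded associative unital algebra; it is supercommutative if $ab=(-1)^{p(a)p(b)}ba$ for homogeneous $a,b$ of parities $p(a),p(b)$. Elements of $A_0$ are even, those of $A_1$ odd. **The supergroup.** A supermatrix over $A$ is $M=\begin{pmatrix} P & B\\ C& D\end{pmatrix}$ with entries of $P$ (size $p\times p$) and $D$ (size $q\times q$) in $A_0$ and entries of $B,C$ in $A_1$. If $P$ and $D$ are invertible, $\mathrm{sdet}(M)=\det(P-BD^{-1}C)\det(D^{-1})$. The supertranspose is $M^{st}=\begin{pmatrix} P^t & C^t\\ -B^t & D^t\end{pmatrix}$. Let $J_{1,1}=\begin{pmatrix}0&1&0\\-1&0&0\\0&0&-1\end{pmatrix}$. $SpO(2|1)$ is defined by its functor of points: $SpO(2|1)(A)$ is the set of supermatrices $M$ over $A$ of size $(2+1)\times(2+1)$ (even blocks of sizes $2\times2$ and $1\times1$) such that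 $\mathrm{sdet}(M)=1$ and $M^{st}J_{1,1}M=J_{1,1}$. **Superquivers.** A superquiver $Q$ is a finite quiver whose vertices are even vertices $x_1,\dots,x_m$ and odd vertices $y_1,\dots,y_n$, each vertex being declared mutable or frozen. There are no $2$-cycles between two even vertices or between two odd vertices, and no loops at even vertices; loops at odd vertices and $2$-cycles between an even and an odd vertex are allowed. Standing restriction: if there is more than one odd vertex, then for every path $y_i\to x_k\to y_j$ with $i\ne j$, $x_k$ mutable and no arrow from $y_i$ to $y_j$, at least one of the following holds: (C1) $x_k$ is not adjacent (by an arrow in either direction) to any mutable even vertex; (C2) the number of arrows $y_i\to x_k$ equals the number of arrows $x_k\to y_i$, and the number of arrows $x_k\to y_j$ equals the number of arrows $y_j\to x_k$. **Seeds.** An initial seed $(X|Y,Q)$ consists of commuting even variables $X=\{x_1,\dots,x_m\}$, anticommuting odd variables $Y=\{y_1,\dots,y_n\}$ (even variables commute with everything), and a superquiver $Q$ whose vertices are labeled by these variables. All computations take place in $\mathbb K(x_1,\dots,x_m)\otimes\mathbb K[y_1,\dots,y_n]$, with $\mathbb K[y_1,\dots,y_n]$ the Grassmann (exterior) algebra on the $y_j$. Below, $x_i,y_j$ denote the variables of the current seed; empty products are $1$ and empty sums are $0$; products over arrows are with multiplicity. **Even mutation** $\mu_k$ at a mutable even vertex $x_k$: all variables other than $x_k$ are unchanged and $$\mu_k(x_k)=\frac1{x_k}\Big[(-1)^u\prod_{x_i\to x_k}x_i+(-1)^v\prod_{x_k\to x_j}x_j+\sum y_iy_j\Big],$$ where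 $u$ is the number of loops on odd vertices adjacent to even vertices $x_i$ with $x_i\to x_k$ ($a$ arrows $x_i\to x_k$, $b$ arrows between $y_j$ and $x_i$, $c$ loops on $y_j$ contribute $abc$), $v$ is defined likewise using arrows $x_k\to x_j$, and the last sum is over ordered pairs $(i,j)$, $i\neq j$, with a path $y_i\to x_k\to y_j$ and no arrow $y_i\to y_j$ ($a$ arrows $y_i\to x_k$ and $b$ arrows $x_k\to y_j$ contribute $ab\,y_iy_j$). The superquiver $\mu_k(Q)$: add an arrow $x_i\to x_j$ for each path $x_i\to x_k\to x_j$ of even vertices; reverse all arrows joining $x_k$ to even vertices; delete all $2$-cycles created between even vertices. All other arrows are unchanged. **Odd mutation** $\eta_i$ at a mutable odd vertex $y_i$: all variables other than $y_i$ are unchanged and $$\eta_i(y_i)=\delta(y_i)y_i+\Big(\prod_{x_k\leftrightarrows y_i}\frac1{x_k}\Big)\Big[\Big(\sum_{y_i\to y_j}y_j\Big)P_{out}+\Big(\sum_{y_j\to y_i}y_j\Big)P_{in}\Big],$$ where $\delta(y_i)=1$ if there is no arrow between $y_i$ and another odd vertex and $\delta(y_i)=0$ otherwise; in the first product $x_k$ has multiplicity $ab$ if there are $a$ arrows $x_k\to y_i$ and $b$ arrows $y_i\to x_k$; $P_{out}$ is the product of the $x_l$ over all configurations consisting of a path $y_i\to x_l\to y_j$ together with an arrow $y_i\to y_j$ (multiplicity $abc$ for $a$ arrows $y_i\to x_l$, $b$ arrows $x_l\to y_j$, $c$ arrows $y_i\to y_j$); $P_{in}$ is the product of the $x_l$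 over all configurations consisting of a path $y_j\to x_l\to y_i$ together with an arrow $y_j\to y_i$, with analogous multiplicity; the two sums and $P_{in}$ only involve $j\ne i$. The superquiver $\eta_i(Q)$: add an arrow $y_k\to y_j$ for each path $y_k\to y_i\to y_j$ with $k\neq i\neq j$; reverse all arrows incident to $y_i$ (including those to even vertices); delete all $2$-cycles created between odd vertices. **Cluster superalgebra.** Let $\mathcal X_{even}$ be the set of all even variables (frozen ones included) obtained from the initial seed by finite (possibly empty) sequences of even mutations, and $\mathcal X_{odd}$ the set of all odd variables obtained from the initial seed by finite sequences of odd mutations. $\mathcal C_{\mathbb K}(X|Y,Q)$ is the supercommutative $\mathbb K$-superalgebra generated by $\mathcal X_{even}\cup\mathcal X_{odd}$. *)

(* Defs.v *)
From HB Require Import structures.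
From mathcomp Require Import all_boot all_order all_algebra all_field.
From mathcomp Require Import mpoly ring.
From mathcomp Require Import boolp.

Set Implicit Arguments.
Unset Strict Implicit.
Unset Printing Implicit Defensive.

Import GRing.Theory.
Local Open Scope ring_scope.

(* A unital K-algebra is presented as a ring with a central ring morphism [kscal]
   from K, rather than as an [algType], because the latter excludes the zero
   algebra.  [of_parity b] is the homogeneous component of parity [b], with
   [false] standing for even. *)
HB.mixin Record isSuperalgebra (K : fieldType) A of GRing.PzRing A := {
  kscal : {rmorphism K -> A};
  kscalC : forall (a : K) (x : A), kscal a * x = x * kscal a;
  of_parity : bool -> A -> Prop;
  of_parity0 : forall b, of_parity b 0;
  of_parityD : forall b x y, of_parity b x -> of_parity b y ->
    of_parity b (x + y);
  of_parityZ : forall b (a : K) x, of_parity b x -> of_parity b (kscal a * x);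
  of_parity1 : of_parity false 1;
  of_parityM : forall b c x y, of_parity b x -> of_parity c y ->
    of_parity (b (+) c) (x * y);
  parity_sum : forall x, exists y z,
    [/\ of_parity false y, of_parity true z & x = y + z];
  parity_cap : forall x, of_parity false x -> of_parity true x -> x = 0
}.

#[short(type="superalgType")]
HB.structure Definition Superalgebra (K : fieldType) :=
  {A of isSuperalgebra K A & GRing.PzRing A}.

HB.mixin Record isSupercommutative (K : fieldType) A of Superalgebra K A := {
  supermulC : forall b c (x y : A), of_parity b x -> of_parity c y ->
    x * y = (-1) ^+ (b && c) * (y * x)
}.

#[short(type="comSuperalgType")]
HB.structure Definition ComSuperalgebra (K : fieldType) :=
  {A of isSupercommutative K A & Superalgebra K A}.

HB.mixin Record isSuperalgMorphism (K : fieldType) (A B : superalgType K)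
    (f : A -> B) := {
  kscal_map : forall a : K, f (kscal a) = kscal a;
  parity_map : forall b x, of_parity b x -> of_parity b (f x)
}.

#[short(type="superhom")]
HB.structure Definition SuperHom (K : fieldType) (A B : superalgType K) :=
  {f of isSuperalgMorphism K A B f & @GRing.RMorphism A B f}.

Lemma superhom_eq (K : fieldType) (A B : superalgType K) (f g : superhom A B) :
  f =1 g -> f = g.
Proof.
case: f => f [m1 m2 m3]; case: g => g [k1 k2 k3] /= /funext fg; subst g.
have -> : k1 = m1 by case: k1 m1 => ? ? [? ?]; congr isSuperalgMorphism.Axioms_;
  exact: Prop_irrelevance.
have -> : k2 = m2 by case: k2 m2 => ? [?]; f_equal; exact: Prop_irrelevance.
by have -> : k3 = m3 by case: k3 m3 => ? [?]; f_equal; exact: Prop_irrelevance.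
Qed.

Section Supermatrices.
Variables (K : fieldType) (A : superalgType K) (p q : nat).
Implicit Types M : 'M[A]_(p + q).

Definition parity_mx b m n (N : 'M[A]_(m, n)) : Prop :=
  forall i j, of_parity b (N i j).

Definition supermatrix M : Prop :=
  [/\ parity_mx false (ulsubmx M), parity_mx true (ursubmx M),
      parity_mx true (dlsubmx M) & parity_mx false (drsubmx M)].

Definition supertranspose M : 'M[A]_(p + q) :=
  block_mx (ulsubmx M)^T (dlsubmx M)^T (- (ursubmx M)^T) (drsubmx M)^T.

Definition even_inverse n (N N' : 'M[A]_n) : Prop :=
  [/\ parity_mx false N', N *m N' = 1%:M & N' *m N = 1%:M].

(* [sdet] is defined only when both diagonal blocks are invertible over the
   even part, hence a relation; [D'] is unique when it exists. *)
Definition is_sdet M (s : A) : Prop :=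
  exists P' D', [/\ even_inverse (ulsubmx M) P', even_inverse (drsubmx M) D' &
    s = \det (ulsubmx M - ursubmx M *m D' *m dlsubmx M) * \det D'].

End Supermatrices.

Definition J11 (A : pzRingType) : 'M[A]_(2 + 1) :=
  \matrix_(i < 3, j < 3)
    nth 0 (nth [::] [:: [:: 0; 1; 0]; [:: -1; 0; 0]; [:: 0; 0; -1]] i) j.

Definition in_SpO21 (K : fieldType) (A : superalgType K) (M : 'M[A]_(2 + 1)) :=
  [/\ supermatrix M, is_sdet M 1 & supertranspose M *m J11 A *m M = J11 A].

Definition SpO21 (K : fieldType) (A : superalgType K) : Type :=
  {M : 'M[A]_(2 + 1) | in_SpO21 M}.

Section Functoriality.
Variables (K : fieldType) (A B : superalgType K) (f : superhom A B).

Lemma parity_map_mx b m n (N : 'M[A]_(m, n)) :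
  parity_mx b N -> parity_mx b (map_mx f N).
Proof. by move=> hN i j; rewrite mxE; apply: parity_map. Qed.

Lemma super_det_map_mx n (N : 'M[A]_n) : \det (map_mx f N) = f (\det N).
Proof.
rewrite /determinant rmorph_sum; apply: eq_bigr => s _.
rewrite rmorphM rmorphXn rmorphN1 rmorph_prod; congr (_ * _).
by apply: eq_bigr => i _; rewrite mxE.
Qed.

Lemma even_inverse_map n (N N' : 'M[A]_n) :
  even_inverse N N' -> even_inverse (map_mx f N) (map_mx f N').
Proof.
move=> [h e1 e2]; split; first exact: parity_map_mx.
  by rewrite -map_mxM e1 map_mx1.
by rewrite -map_mxM e2 map_mx1.
Qed.

Lemma in_SpO21_map (M : 'M[A]_(2 + 1)) : in_SpO21 M -> in_SpO21 (map_mx f M).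
Proof.
move=> [[h1 h2 h3 h4] [P' [D' [hP hD hs]]] hJ]; split.
- rewrite /supermatrix -map_ulsubmx -map_ursubmx -map_dlsubmx -map_drsubmx.
  by split; apply: parity_map_mx.
- exists (map_mx f P'), (map_mx f D').
  rewrite -map_ulsubmx -map_ursubmx -map_dlsubmx -map_drsubmx.
  split; try exact: even_inverse_map.
  by rewrite -!map_mxM -map_mxB !super_det_map_mx -rmorphM -hs rmorph1.
- have J : map_mx f (J11 A) = J11 B.
    apply/matrixP => i j; rewrite !mxE.
    case: i => [[|[|[|//]]] ?]; case: j => [[|[|[|//]]] ?] /=;
    by rewrite ?rmorph0 ?rmorphN ?rmorph1.
  have T : map_mx f (supertranspose M) = supertranspose (map_mx f M).
    rewrite /supertranspose map_block_mx -map_ulsubmx -map_ursubmx -map_dlsubmx.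
    by rewrite -map_drsubmx map_mxN !map_trmx.
  by rewrite -T -{1}J -!map_mxM hJ J.
Qed.

Definition SpO21_map (M : SpO21 A) : SpO21 B :=
  exist _ (map_mx f (sval M)) (in_SpO21_map (svalP M)).

End Functoriality.

(* The exterior algebra over [F] on y_0, ..., y_(n-1), in the basis of
   monomials y_S = y_i1 ... y_ik, where S = {i1 < ... < ik}. *)
Definition grassmann (F : fieldType) (n : nat) := {ffun {set 'I_n} -> F^o}.

HB.instance Definition _ (F : fieldType) n :=
  Vector.copy (grassmann F n) {ffun {set 'I_n} -> F^o}.

Section Grassmann.
Variables (F : fieldType) (n : nat).
Implicit Types (S T U : {set 'I_n}) (f g h : grassmann F n).

Definition inversions S T : nat := \sum_(i in S) \sum_(j in T) (j < i)%N.

(* y_S * y_T = gsign S T y_(S :|: T). *)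
Definition gsign S T : F :=
  if [disjoint S & T] then (-1) ^+ inversions S T else 0.

Definition gmul f g : grassmann F n :=
  [ffun U => \sum_S \sum_(T | S :|: T == U) gsign S T * f S * g T].

Definition gmonom S : grassmann F n := [ffun U => (U == S)%:R].

Definition gone : grassmann F n := gmonom set0.

Lemma inversionsUl S S' T : [disjoint S & S'] ->
  inversions (S :|: S') T = (inversions S T + inversions S' T)%N.
Proof.
move=> d; rewrite /inversions.
by rewrite -bigU //=; apply: eq_bigl => i; rewrite !inE.
Qed.

Lemma inversionsUr S T T' : [disjoint T & T'] ->
  inversions S (T :|: T') = (inversions S T + inversions S T')%N.
Proof.
move=> d; rewrite /inversions -big_split; apply: eq_bigr => i _ /=.
by rewrite -bigU //=; apply: eq_bigl => j; rewrite !inE.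
Qed.

Lemma gsign_assoc R S T :
  gsign R S * gsign (R :|: S) T = gsign S T * gsign R (S :|: T).
Proof.
rewrite /gsign.
have eRS_T : [disjoint R :|: S & T] = [disjoint R & T] && [disjoint S & T].
  by rewrite -!setI_eq0 setIUl setU_eq0.
have eR_ST : [disjoint R & S :|: T] = [disjoint R & S] && [disjoint R & T].
  by rewrite -!setI_eq0 setIUr setU_eq0.
rewrite eRS_T eR_ST.
have [dRS|] := boolP [disjoint R & S]; last by rewrite ?mul0r ?mulr0.
have [dRT|] := boolP [disjoint R & T]; last by rewrite ?mul0r ?mulr0.
have [dST|] := boolP [disjoint S & T]; last by rewrite ?mul0r ?mulr0.
rewrite -!exprD inversionsUl // inversionsUr //; congr (_ ^+ _).
by rewrite addnA addnC.
Qed.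

Lemma gsign0l S : gsign set0 S = 1.
Proof. by rewrite /gsign -setI_eq0 set0I eqxx /inversions big_set0. Qed.

Lemma gsign0r S : gsign S set0 = 1.
Proof.
rewrite /gsign -setI_eq0 setI0 eqxx /inversions big1 // => i _.
by rewrite big_set0.
Qed.

Lemma gmulE f g U :
  gmul f g U = \sum_S \sum_(T | S :|: T == U) gsign S T * f S * g T.
Proof. by rewrite ffunE. Qed.

Lemma gmulA : associative gmul.
Proof.
move=> f g h; apply/ffunP => U; rewrite !gmulE.
transitivity (\sum_R \sum_S \sum_(T | R :|: S :|: T == U)
  gsign S T * gsign R (S :|: T) * f R * g S * h T).
  apply: eq_bigr => R _; under eq_bigr => W _ do rewrite gmulE mulr_sumr.
  rewrite exchange_big /=; apply: eq_bigr => S _.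
  under eq_bigr => W _ do rewrite mulr_sumr.
  rewrite (exchange_big_dep predT) //= [RHS]big_mkcond; apply: eq_bigr => T _.
  rewrite (eq_bigl (fun W => (W == S :|: T) && (R :|: S :|: T == U))); last first.
    move=> W; rewrite andbC [S :|: T == W]eq_sym; case: eqP => //= ->.
    by rewrite setUA.
  case: ifP => _; last by rewrite big1 // => W; rewrite andbF.
  under eq_bigl => W do rewrite andbT.
  rewrite big_pred1_eq; ring.
transitivity (\sum_W \sum_(T | W :|: T == U) \sum_R \sum_(S | R :|: S == W)
    gsign R S * gsign W T * f R * g S * h T); last first.
  apply: eq_bigr => W _; apply: eq_bigr => T _; rewrite gmulE mulr_sumr mulr_suml.
  apply: eq_bigr => R _; rewrite mulr_sumr mulr_suml.
  by apply: eq_bigr => S _; ring.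
transitivity (\sum_W \sum_R \sum_(S | W == R :|: S) \sum_(T | W :|: T == U)
    gsign R S * gsign W T * f R * g S * h T); last first.
  apply: eq_bigr => W _; rewrite [RHS]exchange_big; apply: eq_bigr => R _.
  by rewrite [RHS]exchange_big; apply: eq_bigl => S; rewrite eq_sym.
rewrite [RHS]exchange_big; apply: eq_bigr => R _.
rewrite [RHS](exchange_big_dep predT) //=; apply: eq_bigr => S _.
rewrite big_pred1_eq; apply: eq_bigr => T _.
by rewrite gsign_assoc.
Qed.

Lemma gmul1g : left_id gone gmul.
Proof.
move=> f; apply/ffunP => U; rewrite gmulE (bigD1 set0) //= [X in _ + X]big1 ?addr0.
  under eq_bigl => T do rewrite set0U.
  by rewrite big_pred1_eq gsign0l ffunE eqxx !mul1r.
by move=> S /negbTE nS; rewrite big1 // => T _; rewrite ffunE nS mulr0 mul0r.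
Qed.

Lemma gmulg1 : right_id gone gmul.
Proof.
move=> f; apply/ffunP => U; rewrite gmulE (bigD1 U) //= [X in _ + X]big1 ?addr0.
  rewrite (bigD1 set0) ?setU0 //= gsign0r ffunE eqxx mulr1 mul1r big1 ?addr0 //.
  by move=> T /andP [_ /negbTE nT]; rewrite ffunE nT mulr0.
move=> S nS; rewrite big1 // => T /eqP eU; rewrite ffunE.
have /negbTE -> : T != set0 by apply: contraNneq nS => T0; rewrite -eU T0 setU0.
by rewrite mulr0.
Qed.

Lemma gmulDl : left_distributive gmul +%R.
Proof.
move=> f g h; apply/ffunP => U; rewrite [RHS]ffunE !gmulE -big_split.
apply: eq_bigr => S _ /=; rewrite -big_split; apply: eq_bigr => T _ /=.
by rewrite ffunE mulrDr mulrDl.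
Qed.

Lemma gmulDr : right_distributive gmul +%R.
Proof.
move=> f g h; apply/ffunP => U; rewrite [RHS]ffunE !gmulE -big_split.
apply: eq_bigr => S _ /=; rewrite -big_split; apply: eq_bigr => T _ /=.
by rewrite ffunE mulrDr.
Qed.

Lemma gone_neq0 : gone != 0.
Proof.
by apply/eqP => /ffunP /(_ set0) /eqP; rewrite !ffunE eqxx oner_eq0.
Qed.

Lemma gscaleAl (a : F) f g : a *: gmul f g = gmul (a *: f) g.
Proof.
apply/ffunP => U; rewrite [LHS]ffunE !gmulE scaler_sumr; apply: eq_bigr => S _.
rewrite scaler_sumr; apply: eq_bigr => T _; rewrite ffunE /GRing.scale /=; ring.
Qed.

Lemma gscaleAr (a : F) f g : a *: gmul f g = gmul f (a *: g).
Proof.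
apply/ffunP => U; rewrite [LHS]ffunE !gmulE scaler_sumr; apply: eq_bigr => S _.
rewrite scaler_sumr; apply: eq_bigr => T _; rewrite ffunE /GRing.scale /=; ring.
Qed.

HB.instance Definition _ := GRing.Zmodule_isNzRing.Build (grassmann F n)
  gmulA gmul1g gmulg1 gmulDl gmulDr gone_neq0.
HB.instance Definition _ := GRing.Lmodule_isLalgebra.Build F (grassmann F n)
  gscaleAl.
HB.instance Definition _ := GRing.Lalgebra_isAlgebra.Build F (grassmann F n)
  gscaleAr.
(* Finite dimensionality provides the inverse of units. *)
HB.instance Definition _ := Algebra_isFalgebra.Build F (grassmann F n).

Definition gparity (b : bool) f : Prop := forall S, odd #|S| != b -> f S = 0.

Lemma gparity0 b : gparity b 0.
Proof. by move=> S _; rewrite ffunE. Qed.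

Lemma gparityD b f g : gparity b f -> gparity b g -> gparity b (f + g).
Proof. by move=> hf hg S hS; rewrite ffunE hf // hg // addr0. Qed.

Lemma gparityN b f : gparity b f -> gparity b (- f).
Proof. by move=> hf S hS; rewrite ffunE hf // oppr0. Qed.

Lemma gparityZ b (a : F) f : gparity b f -> gparity b (a *: f).
Proof. by move=> hf S hS; rewrite ffunE hf // scaler0. Qed.

Lemma gparity1 : gparity false 1.
Proof.
by move=> S; rewrite ffunE; have [->|//] := eqVneq S set0; rewrite cards0.
Qed.

Lemma gparityM b c f g : gparity b f -> gparity c g -> gparity (b (+) c) (f * g).
Proof.
move=> hf hg U hU; rewrite [LHS]gmulE big1 // => S _; rewrite big1 // => T /eqP eU.
have [dST|/negbTE nd] := boolP [disjoint S & T]; last by rewrite /gsign nd !mul0r.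
have [eS|nS] := eqVneq (odd #|S|) b; last by rewrite hf // mulr0 mul0r.
have [eT|nT] := eqVneq (odd #|T|) c; last by rewrite hg // mulr0.
by move: hU; rewrite -eU cardsU disjoint_setI0 // cards0 subn0 oddD eS eT eqxx.
Qed.

Definition gpart (b : bool) f : grassmann F n :=
  [ffun S : {set 'I_n} => if odd #|S| == b then f S else 0].

Lemma gpartP b f : gparity b (gpart b f).
Proof. by move=> S /negbTE hS; rewrite ffunE hS. Qed.

Lemma gpartE f : f = gpart false f + gpart true f.
Proof.
by apply/ffunP => S; rewrite [RHS]ffunE !ffunE; case: odd; rewrite ?addr0 ?add0r.
Qed.

Lemma gparity_cap f : gparity false f -> gparity true f -> f = 0.
Proof.
move=> h0 h1; apply/ffunP => S; rewrite ffunE.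
by case eS: (odd #|S|); [apply: h0 | apply: h1]; rewrite eS.
Qed.

Lemma gpart_unique f x y : gparity false x -> gparity true y -> f = x + y ->
  gpart false f = x /\ gpart true f = y.
Proof.
move=> hx hy ->; split; apply/ffunP => S; rewrite ffunE ffunE.
  by case: eqP => [eS|/eqP nS]; [rewrite hy ?addr0 ?eS | rewrite hx].
by case: eqP => [eS|/eqP nS]; [rewrite hx ?add0r ?eS | rewrite hy].
Qed.

Lemma gparity_inv f : gparity false f -> gparity false f^-1.
Proof.
have [fu hf|nu] := boolP (f \is a GRing.unit); last by rewrite invr_out.
set y := f^-1.
have hodd : gparity true (f * gpart true y) by apply: (@gparityM false true) => //; exact: gpartP.
have heven : gparity false (f * gpart true y).
  have -> : f * gpart true y = 1 - f * gpart false y.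
    have <- : f * gpart false y + f * gpart true y = 1.
      by rewrite -mulrDr -gpartE divrr.
    by rewrite addrC addKr.
  apply: gparityD; first exact: gparity1.
  apply: gparityN; apply: (@gparityM false false) => //; exact: gpartP.
have y1 : gpart true y = 0.
  by apply: (mulrI fu); rewrite mulr0; exact: gparity_cap.
by rewrite [y]gpartE y1 addr0; exact: gpartP.
Qed.

Lemma gparityX f k : gparity false f -> gparity false (f ^+ k).
Proof.
move=> hf; elim: k => [|k IH]; first exact: gparity1.
by rewrite exprS; apply: (@gparityM false false).
Qed.

Lemma gparityMn b f k : gparity b f -> gparity b (f *+ k).
Proof.
move=> hf; elim: k => [|k IH]; first exact: gparity0.
by rewrite mulrS; exact: gparityD.
Qed.

Lemma gparity_gsum (I : finType) (P : pred I) b (f : I -> grassmann F n) :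
  (forall i, gparity b (f i)) -> gparity b (\sum_(i | P i) f i).
Proof. by move=> hf; elim/big_ind: _ => //; [exact: gparity0 | exact: gparityD]. Qed.

Lemma gparity_gprod (I : finType) (P : pred I) (f : I -> grassmann F n) :
  (forall i, gparity false (f i)) -> gparity false (\prod_(i | P i) f i).
Proof.
move=> hf; elim/big_ind: _ => //; first exact: gparity1.
by move=> x y hx hy; apply: (@gparityM false false).
Qed.

Lemma gsignC S T : gsign S T = (-1) ^+ (#|S| * #|T|) * gsign T S.
Proof.
rewrite /gsign [in RHS]disjoint_sym.
have [dST|] := boolP [disjoint S & T]; last by rewrite mulr0.
suff -> : (#|S| * #|T|)%N = (inversions S T + inversions T S)%N.
  by rewrite -exprD -addnA addnn exprD -[_ ^+ _.*2]signr_odd odd_double mulr1.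
rewrite /inversions [X in (_ + X)%N]exchange_big -big_split /= -sum_nat_const.
apply: eq_bigr => i iS; rewrite -big_split /= -sum1_card; apply: eq_bigr => j jT.
have : i != j by apply: contraTneq jT => <-; rewrite (disjointFr dST iS).
by rewrite -val_eqE /=; case: ltngtP.
Qed.

Lemma gmul_supercomm b c f g : gparity b f -> gparity c g ->
  f * g = (-1) ^+ (b && c) * (g * f).
Proof.
move=> hf hg.
have -> : (-1) ^+ (b && c) * (g * f) = ((-1 : F) ^+ (b && c)) *: (g * f).
  by case: (b && c); rewrite ?expr1 ?expr0 ?mulN1r ?scaleN1r ?mul1r ?scale1r.
apply/ffunP => U; rewrite [RHS]ffunE [LHS]gmulE [in RHS]gmulE.
rewrite [in RHS](exchange_big_dep predT) //= scaler_sumr; apply: eq_bigr => S _.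
rewrite scaler_sumr; apply: eq_big => [T|T _]; first by rewrite setUC.
rewrite /GRing.scale /= gsignC.
have [eS|nS] := eqVneq (odd #|S|) b; last by rewrite hf // !(mulr0, mul0r).
have [eT|nT] := eqVneq (odd #|T|) c; last by rewrite hg // !(mulr0, mul0r).
rewrite -signr_odd oddM eS eT; ring.
Qed.

End Grassmann.

Definition vertex (m n : nat) := ('I_m + 'I_n)%type.

(* [inl k] is the even vertex x_k, [inr i] the odd vertex y_i, and [Q a b] the
   number of arrows from [a] to [b]. *)
Record quiver (m n : nat) := Quiver {
  arrows :> vertex m n -> vertex m n -> nat;
  mutable : pred (vertex m n)
}.

Section Superquivers.
Variables (m n : nat).
Implicit Type Q : quiver m n.
Local Notation x k := (inl k : vertex m n).
Local Notation y i := (inr i : vertex m n).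

Definition standing_restriction Q : Prop :=
  forall (i j : 'I_n) (k : 'I_m), i != j -> mutable Q (x k) ->
    (0 < Q (y i) (x k))%N -> (0 < Q (x k) (y j))%N -> Q (y i) (y j) = 0%N ->
    (forall l, mutable Q (x l) -> Q (x k) (x l) = 0%N /\ Q (x l) (x k) = 0%N)
    \/ (Q (y i) (x k) = Q (x k) (y i) /\ Q (x k) (y j) = Q (y j) (x k)).

Definition superquiver Q : Prop :=
  [/\ forall k, Q (x k) (x k) = 0%N,
      forall k l, k != l -> Q (x k) (x l) = 0%N \/ Q (x l) (x k) = 0%N,
      forall i j, i != j -> Q (y i) (y j) = 0%N \/ Q (y j) (y i) = 0%N
    & standing_restriction Q].

(* Truncated subtraction implements the deletion of 2-cycles. *)
Definition even_quiver_mutation (k : 'I_m) Q : quiver m n :=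
  Quiver (fun a b => match a, b with
    | inl i, inl j =>
        if (i == k) || (j == k) then Q (x j) (x i)
        else (Q (x i) (x j) + Q (x i) (x k) * Q (x k) (x j)
              - (Q (x j) (x i) + Q (x j) (x k) * Q (x k) (x i)))%N
    | _, _ => Q a b
    end) (mutable Q).

(* The loops at [y j], which are not 2-cycles, are kept. *)
Definition odd_quiver_mutation (i : 'I_n) Q : quiver m n :=
  Quiver (fun a b =>
    if (a == y i) || (b == y i) then Q b a
    else match a, b with
    | inr j, inr l =>
        let new u v := (Q (y u) (y v) + Q (y u) (y i) * Q (y i) (y v))%N in
        if j == l then new j j else (new j l - new l j)%N
    | _, _ => Q a b
    end) (mutable Q).

End Superquivers.

(* The tensor product over K of K(x_0, ..., x_(m-1)) and of the Grassmann algebra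
   K[y_0, ..., y_(n-1)] is the Grassmann algebra over K(x_0, ..., x_(m-1)). *)
Notation ambient K m n := (grassmann {fraction {mpoly K[m]}} n).

Record seed (K : fieldType) (m n : nat) := Seed {
  evar : 'I_m -> ambient K m n;
  ovar : 'I_n -> ambient K m n;
  squiver : quiver m n
}.

Section Mutations.
Variables (K : fieldType) (m n : nat).
Implicit Types (s : seed K m n) (Q : quiver m n).
Local Notation x k := (inl k : vertex m n).
Local Notation y i := (inr i : vertex m n).

Definition initial_seed Q : seed K m n :=
  Seed (fun k => (tofrac ('X_k : {mpoly K[m]}))%:A) (fun i => gmonom _ [set i]) Q.

Definition loops_near (Q : quiver m n) (i : 'I_m) : nat :=
  (\sum_j (Q (x i) (y j) + Q (y j) (x i)) * Q (y j) (y j))%N.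

Definition even_exchange (k : 'I_m) s : ambient K m n :=
  let Q := squiver s in
  let u := (\sum_i Q (x i) (x k) * loops_near Q i)%N in
  let v := (\sum_j Q (x k) (x j) * loops_near Q j)%N in
  (evar s k)^-1 *
    ((-1) ^+ u * \prod_i evar s i ^+ Q (x i) (x k)
     + (-1) ^+ v * \prod_j evar s j ^+ Q (x k) (x j)
     + \sum_i \sum_(j | (i != j) && (Q (y i) (y j) == 0%N))
         (ovar s i * ovar s j) *+ (Q (y i) (x k) * Q (x k) (y j))).

Definition even_mutation (k : 'I_m) s : seed K m n :=
  Seed (fun l => if l == k then even_exchange k s else evar s l) (ovar s)
    (even_quiver_mutation k (squiver s)).

(* The sums run over arrows, hence with multiplicity.  [P_out], unlike [P_in] and
   the two sums, involves the index [j = i]. *)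
Definition odd_exchange (i : 'I_n) s : ambient K m n :=
  let Q := squiver s in
  let isolated := [forall (j | j != i), (Q (y i) (y j) == 0%N)
                                        && (Q (y j) (y i) == 0%N)] in
  let P_out := \prod_l \prod_j
    evar s l ^+ (Q (y i) (x l) * Q (x l) (y j) * Q (y i) (y j)) in
  let P_in := \prod_l \prod_(j | j != i)
    evar s l ^+ (Q (y j) (x l) * Q (x l) (y i) * Q (y j) (y i)) in
  (if isolated then ovar s i else 0)
  + (\prod_k (evar s k)^-1 ^+ (Q (x k) (y i) * Q (y i) (x k)))
    * ((\sum_(j | j != i) ovar s j *+ Q (y i) (y j)) * P_out
       + (\sum_(j | j != i) ovar s j *+ Q (y j) (y i)) * P_in).

Definition odd_mutation (i : 'I_n) s : seed K m n :=
  Seed (evar s) (fun j => if j == i then odd_exchange i s else ovar s j)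
    (odd_quiver_mutation i (squiver s)).

(* The exchange relation makes sense only if 1/x_k exists, and [^-1] has a
   meaningless value on nonunits.  Even variables are left unchanged by odd
   mutations, so that the question does not arise there. *)
Inductive even_reachable (s0 : seed K m n) : seed K m n -> Prop :=
| even_reachable0 : even_reachable s0 s0
| even_reachableS s k : even_reachable s0 s -> mutable (squiver s) (inl k) ->
    evar s k \is a GRing.unit -> even_reachable s0 (even_mutation k s).

Inductive odd_reachable (s0 : seed K m n) : seed K m n -> Prop :=
| odd_reachable0 : odd_reachable s0 s0
| odd_reachableS s i : odd_reachable s0 s -> mutable (squiver s) (inr i) ->
    odd_reachable s0 (odd_mutation i s).

Definition cluster_even Q (z : ambient K m n) : Prop :=
  exists s k, even_reachable (initial_seed Q) s /\ z = evar s k.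

Definition cluster_odd Q (z : ambient K m n) : Prop :=
  exists s i, odd_reachable (initial_seed Q) s /\ z = ovar s i.

Definition kconst : K -> ambient K m n :=
  in_alg (ambient K m n) \o @tofrac {mpoly K[m]} \o @mpolyC m K.

HB.instance Definition _ := GRing.RMorphism.on kconst.

Inductive cluster_generated Q : ambient K m n -> Prop :=
| generated_even z : cluster_even Q z -> cluster_generated Q z
| generated_odd z : cluster_odd Q z -> cluster_generated Q z
| generated_const a : cluster_generated Q (kconst a)
| generated_add z t : cluster_generated Q z -> cluster_generated Q t ->
    cluster_generated Q (z + t)
| generated_mul z t : cluster_generated Q z -> cluster_generated Q t ->
    cluster_generated Q (z * t).

Lemma gparity_sign k : gparity false ((-1) ^+ k : ambient K m n).
Proof. by apply: gparityX; apply: gparityN; exact: gparity1. Qed.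

Lemma cluster_even_parity Q z : cluster_even Q z -> gparity false z.
Proof.
move=> [s [k [hs ->]]].
suff [h _] : (forall l, gparity false (evar s l)) /\
    (forall i, gparity true (ovar s i)) by exact: h.
elim: hs => [|{k} {}s k _ [he ho] _ _]; split => //=.
- by move=> l; apply: gparityZ; exact: gparity1.
- by move=> i S; rewrite ffunE; have [->|//] := eqVneq S [set i]; rewrite cards1.
move=> l; have [_|_] := eqVneq l k; last exact: he.
apply: (@gparityM _ _ false false); first exact: gparity_inv.
apply: gparityD; first apply: gparityD.
- apply: (@gparityM _ _ false false); first exact: gparity_sign.
  by apply: gparity_gprod => i; exact: gparityX.
- apply: (@gparityM _ _ false false); first exact: gparity_sign.
  by apply: gparity_gprod => i; exact: gparityX.
- apply: gparity_gsum => i; apply: gparity_gsum => j; apply: gparityMn.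
  by apply: (@gparityM _ _ true true).
Qed.

Lemma cluster_odd_parity Q z : cluster_odd Q z -> gparity true z.
Proof.
move=> [s [i [hs ->]]].
suff [_ h] : (forall l, gparity false (evar s l)) /\
    (forall i, gparity true (ovar s i)) by exact: h.
elim: hs => [|{i} {}s i _ [he ho] _]; split => //=.
- by move=> l; apply: gparityZ; exact: gparity1.
- by move=> i' S; rewrite ffunE; have [->|//] := eqVneq S [set i']; rewrite cards1.
move=> j; have [_|_] := eqVneq j i; last exact: ho.
apply: gparityD; first by case: ifP => _; [exact: ho | exact: gparity0].
apply: (@gparityM _ _ false true).
  by apply: gparity_gprod => l; apply: gparityX; exact: gparity_inv.
apply: gparityD; apply: (@gparityM _ _ true false).
- by apply: gparity_gsum => l; exact: gparityMn.
- by do 2!apply: gparity_gprod => ?; exact: gparityX.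
- by apply: gparity_gsum => l; exact: gparityMn.
- by do 2!apply: gparity_gprod => ?; exact: gparityX.
Qed.

Lemma kconst_parity a : gparity false (kconst a).
Proof. by apply: gparityZ; exact: gparity1. Qed.

Lemma cluster_generated0 Q : cluster_generated Q 0.
Proof. by rewrite -(rmorph0 kconst); exact: generated_const. Qed.

Lemma cluster_generated_part Q b z :
  cluster_generated Q z -> cluster_generated Q (gpart b z).
Proof.
have split2 (u v w : ambient K m n) : gparity false u -> gparity true v ->
    w = u + v -> cluster_generated Q u -> cluster_generated Q v ->
    forall c, cluster_generated Q (gpart c w).
  move=> hu hv hw gu gv c; have [e0 e1] := @gpart_unique _ _ w u v hu hv hw.
  by case: c; rewrite ?e0 ?e1.
have g0 := cluster_generated0 Q.
move=> hz; move: b; elim: hz => {z} [z hz|z hz|a|z t gz hz gt ht|z t gz hz gt ht].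
- apply: (@split2 z 0); rewrite ?addr0 //; last exact: generated_even.
    exact: cluster_even_parity hz.
  exact: gparity0.
- apply: (@split2 0 z); rewrite ?add0r //; last exact: generated_odd.
    exact: gparity0.
  exact: cluster_odd_parity hz.
- apply: (@split2 (kconst a) 0); rewrite ?addr0 //; last exact: generated_const.
    exact: kconst_parity.
  exact: gparity0.
- apply: (@split2 (gpart false z + gpart false t) (gpart true z + gpart true t)).
  + by apply: gparityD; exact: gpartP.
  + by apply: gparityD; exact: gpartP.
  + by rewrite addrACA -!gpartE.
  + exact: generated_add.
  + exact: generated_add.
- apply: (@split2 (gpart false z * gpart false t + gpart true z * gpart true t)
      (gpart false z * gpart true t + gpart true z * gpart false t)).
  + apply: gparityD; [apply: (@gparityM _ _ false false) |
      apply: (@gparityM _ _ true true)]; exact: gpartP.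
  + apply: gparityD; [apply: (@gparityM _ _ false true) |
      apply: (@gparityM _ _ true false)]; exact: gpartP.
  + rewrite [in LHS](gpartE z) [in LHS](gpartE t) mulrDl !mulrDr.
    by rewrite -!addrA; congr (_ + _); rewrite addrA addrC.
  + by apply: generated_add; exact: generated_mul.
  + by apply: generated_add; exact: generated_mul.
Qed.

Definition in_cluster Q : {pred ambient K m n} :=
  fun z => `[< cluster_generated Q z >].

Lemma in_clusterP Q z : reflect (cluster_generated Q z) (z \in in_cluster Q).
Proof. exact: asboolP. Qed.

Lemma in_cluster_subring Q : GRing.subring_closed (in_cluster Q).
Proof.
split=> [|z t /in_clusterP hz /in_clusterP ht|z t /in_clusterP hz /in_clusterP ht].
- by apply/in_clusterP; rewrite -(rmorph1 kconst); exact: generated_const.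
- apply/in_clusterP; apply: generated_add hz _; rewrite -mulN1r.
  apply: generated_mul ht; rewrite -(rmorph1 kconst) -rmorphN.
  exact: generated_const.
- by apply/in_clusterP; exact: generated_mul.
Qed.

HB.instance Definition _ Q := GRing.isSubringClosed.Build _ (in_cluster Q)
  (in_cluster_subring Q).

End Mutations.

Arguments in_cluster K [m n] Q.

Record cluster_superalgebra (K : fieldType) (m n : nat) (Q : quiver m n) := Cluster {
  cluster_val : ambient K m n;
  _ : cluster_val \in in_cluster K Q
}.

Arguments cluster_superalgebra K [m n] Q.

Section ClusterSuperalgebra.
Variables (K : fieldType) (m n : nat) (Q : quiver m n).
Local Notation C := (cluster_superalgebra K Q).

HB.instance Definition _ := [isSub for @cluster_val K m n Q].
HB.instance Definition _ := [Choice of C by <:].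
HB.instance Definition _ := [SubChoice_isSubNzRing of C by <:].

Lemma in_cluster_kconst a : kconst m n a \in in_cluster K Q.
Proof. by apply/in_clusterP; exact: generated_const. Qed.

Definition cluster_scal (a : K) : C := Cluster (in_cluster_kconst a).

Lemma cluster_scal_zmod : zmod_morphism cluster_scal.
Proof. by move=> a b; apply: val_inj; rewrite /= rmorphB. Qed.

Lemma cluster_scal_monoid : monoid_morphism cluster_scal.
Proof.
by split=> [|a b]; apply: val_inj; rewrite /= ?rmorph1 ?rmorphM.
Qed.

HB.instance Definition _ := GRing.isZmodMorphism.Build K C cluster_scal
  cluster_scal_zmod.
HB.instance Definition _ := GRing.isMonoidMorphism.Build K C cluster_scal
  cluster_scal_monoid.

Definition cluster_parity (b : bool) (z : C) : Prop := gparity b (val z).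

Lemma cluster_scalC a z : cluster_scal a * z = z * cluster_scal a.
Proof. by apply: val_inj; rewrite !rmorphM /= /kconst /= mulr_algl mulr_algr. Qed.

Lemma cluster_parity0 b : cluster_parity b 0.
Proof. exact: gparity0. Qed.

Lemma cluster_parityD b z t :
  cluster_parity b z -> cluster_parity b t -> cluster_parity b (z + t).
Proof. exact: gparityD. Qed.

Lemma cluster_parityM b c z t :
  cluster_parity b z -> cluster_parity c t -> cluster_parity (b (+) c) (z * t).
Proof. exact: gparityM. Qed.

Lemma cluster_parityZ b a z :
  cluster_parity b z -> cluster_parity b (cluster_scal a * z).
Proof. by move=> hz; apply: (@cluster_parityM false) => //; exact: kconst_parity. Qed.

Lemma cluster_parity1 : cluster_parity false 1.
Proof. exact: gparity1. Qed.

Lemma cluster_parity_sum z : exists t u,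
  [/\ cluster_parity false t, cluster_parity true u & z = t + u].
Proof.
have part b : gpart b (val z) \in in_cluster K Q.
  by apply/in_clusterP; apply: cluster_generated_part; apply/in_clusterP; exact: valP.
exists (Cluster (part false)), (Cluster (part true)); split; try exact: gpartP.
by apply: val_inj; rewrite rmorphD /= -gpartE.
Qed.

Lemma cluster_parity_cap z :
  cluster_parity false z -> cluster_parity true z -> z = 0.
Proof. by move=> h0 h1; apply: val_inj; exact: gparity_cap. Qed.

HB.instance Definition _ := isSuperalgebra.Build K C cluster_scalC
  cluster_parity0 cluster_parityD cluster_parityZ cluster_parity1
  cluster_parityM cluster_parity_sum cluster_parity_cap.

Lemma cluster_supermulC b c (z t : C) : of_parity b z -> of_parity c t ->
  z * t = (-1) ^+ (b && c) * (t * z).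
Proof.
move=> hz ht; apply: val_inj; rewrite !rmorphM rmorphXn rmorphN1.
exact: gmul_supercomm.
Qed.

HB.instance Definition _ := isSupercommutative.Build K C cluster_supermulC.

End ClusterSuperalgebra.

(* Main.v *)
Require Import Defs.
From HB Require Import structures.
From mathcomp Require Import all_boot all_order all_algebra all_field.
From mathcomp Require Import fingroup perm mpoly ring boolp.

(** A matrix of SpO(2|1)(A), with rows [(a, b, al)], [(c, d, be)] and
    [(ga, de, e)], is determined by its entries [a, b, c, d] (even) and [al, be]
    (odd), which are subject to the single relation [a * d = 1 + b * c + al * be].
    Indeed the equations [M^st J M = J] read
      [a * d - b * c - ga * de = 1], [ga * e = a * be - c * al],
      [de * e = b * be - d * al], [e ^ 2 = 1 - 2 * al * be].
    With [eps = al * be], which is even of square zero, they give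
    [(a * d - b * c) * (1 - eps) = 1], and then [sdet M = 1] forces [e = 1 - eps],
    whence [ga = a * be - c * al] and [de = b * be - d * al] (lemmas [point_of_mx]
    and [point_mx_in]).  The characteristic matters only through the equation
    [y * y = 0] for odd [y].

    The relation has the shape of an exchange relation.  In the superquiver
    [SpO_quiver] the even vertex [x_0] is the only mutable vertex; there are
    arrows [x_1 -> x_0], [x_2 -> x_0] and a path [y_0 -> x_0 -> y_1].  Mutation
    at [x_0] replaces [x_0] by [(1 + x_1 x_2 + y_0 y_1) / x_0], and mutating
    again restores the initial seed.  Hence the cluster superalgebra is generated
    by [a = x_0], [b = x_1], [c = x_2], [d = (1 + b c + y_0 y_1) / a], [al = y_0]
    and [be = y_1]; these form the universal point.

    No further relation holds between these generators ([supereval_kernel]).  An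
    element is [f1 + f2 al + f3 be + f4 al be] with [f1, ..., f4] polynomials in
    [a, b, c, d].  If it vanishes in the ambient algebra, put
    [d0 = (1 + b c) / a]; Taylor expansion of [d = d0 + al be / a] gives
    [f1(d0) = f2(d0) = f3(d0) = 0] and [f4(d0) + f1'(d0) / a = 0].  A polynomial
    in [d] that vanishes at [d0] is a multiple of [w = a d - (1 + b c)]
    ([fraction_root]), so that [f1 = g1 w], [f2 = g2 w], [f3 = g3 w] and
    [f4 = g4 w - g1].  At any point [w] takes the value [eps], hence
    [f1 + f4 eps = g1 eps + g4 eps ^ 2 - g1 eps = 0], and [f2 al] and [f3 be]
    vanish because [eps al = eps be = 0].

    Therefore morphisms from the cluster superalgebra to [A] correspond to points
    over [A], that is to matrices in SpO(2|1)(A), by [f |-> f(universal matrix)].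
    This map is visibly natural; its inverse is the bijection sought. *)

Set Implicit Arguments.
Unset Strict Implicit.
Unset Printing Implicit Defensive.

Import GRing.Theory.
Local Open Scope ring_scope.

(** * Even elements of a superalgebra *)

Section Superalgebra.
Variables (K : fieldType) (A : superalgType K).
Implicit Types x y : A.

Lemma of_parityN b x : of_parity b x -> of_parity b (- x).
Proof.
by move=> hx; rewrite -mulN1r -(rmorph1 kscal) -rmorphN; exact: of_parityZ.
Qed.

Lemma even_kscal a : of_parity false (kscal a : A).
Proof. by rewrite -[kscal a]mulr1; apply: of_parityZ; exact: of_parity1. Qed.

(** The even elements, as a collective predicate. *)
Definition even : {pred A} := fun x => `[< of_parity false x >].

Lemma evenP x : reflect (of_parity false x) (x \in even).
Proof. exact: asboolP. Qed.

Lemma even_subring : GRing.subring_closed even.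
Proof.
split=> [|x y /evenP hx /evenP hy|x y /evenP hx /evenP hy]; apply/evenP.
- exact: of_parity1.
- by apply: of_parityD => //; exact: of_parityN.
- exact: (@of_parityM _ _ false false).
Qed.

HB.instance Definition _ := GRing.isSubringClosed.Build _ even even_subring.

End Superalgebra.

Arguments even {K} A.

(** The even part of a superalgebra, a subring that is commutative when the
    superalgebra is supercommutative.  It may be the zero ring. *)
Record even_part (K : fieldType) (A : superalgType K) := EvenPart {
  even_val : A;
  _ : even_val \in even A
}.

HB.instance Definition _ (K : fieldType) (A : superalgType K) :=
  [isSub for @even_val K A].
HB.instance Definition _ (K : fieldType) (A : superalgType K) :=
  [Choice of even_part A by <:].
HB.instance Definition _ (K : fieldType) (A : superalgType K) :=
  GRing.SubChoice_isSubPzRing.Build A (even A) (even_part A)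
    (@even_subring K A).

Lemma even_val_parity (K : fieldType) (A : superalgType K) (u : even_part A) :
  of_parity false (val u).
Proof. by apply/evenP; exact: valP. Qed.

Lemma even_mulC (K : fieldType) (A : comSuperalgType K) :
  commutative (@GRing.mul (even_part A)).
Proof.
move=> x y; apply: val_inj; rewrite !rmorphM.
have hx := even_val_parity x; have hy := even_val_parity y.
by rewrite (supermulC _ _ _ _ hx hy) mul1r.
Qed.

HB.instance Definition _ (K : fieldType) (A : comSuperalgType K) :=
  GRing.PzRing_hasCommutativeMul.Build (even_part A) (@even_mulC K A).

(** * Matrices of size two *)

Section SmallMatrices.
Variable R : pzRingType.
Implicit Types (a b c d u v x : R).

(** The matrices with rows [(a, b)] and [(c, d)], with column [(u, v)], and with
    row [(u, v)].  The entries lie in a ring that need not be commutative. *)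
Definition mx2 a b c d : 'M[R]_2 :=
  \matrix_(i, j) if i == 0 then (if j == 0 then a else b)
                 else (if j == 0 then c else d).
Definition col2 u v : 'M[R]_(2, 1) := \matrix_(i, j) if i == 0 then u else v.
Definition row2 u v : 'M[R]_(1, 2) := \matrix_(i, j) if j == 0 then u else v.

Lemma ord2P (i : 'I_2) : i = 0 \/ i = 1.
Proof. by case: i => [[|[|//]] ?]; [left | right]; apply: val_inj. Qed.

Lemma mx2E (P : 'M[R]_2) : P = mx2 (P 0 0) (P 0 1) (P 1 0) (P 1 1).
Proof.
by apply/matrixP => i j; rewrite mxE; case: (ord2P i) => ->;
  case: (ord2P j) => ->.
Qed.

Lemma col2E (B : 'M[R]_(2, 1)) : B = col2 (B 0 0) (B 1 0).
Proof. by apply/matrixP => i j; rewrite mxE !ord1; case: (ord2P i) => ->. Qed.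

Lemma row2E (C : 'M[R]_(1, 2)) : C = row2 (C 0 0) (C 0 1).
Proof. by apply/matrixP => i j; rewrite mxE !ord1; case: (ord2P j) => ->. Qed.

Lemma mx2_inj a b c d a' b' c' d' :
  mx2 a b c d = mx2 a' b' c' d' -> [/\ a = a', b = b', c = c' & d = d'].
Proof.
move=> /matrixP h.
by have := (h 0 0, h 0 1, h 1 0, h 1 1); rewrite !mxE /= => -[[[]]].
Qed.

Lemma col2_inj u v u' v' : col2 u v = col2 u' v' -> u = u' /\ v = v'.
Proof.
by move=> /matrixP h; have := (h 0 0, h 1 0); rewrite !mxE /= => -[].
Qed.

Lemma mx2_mul a b c d a' b' c' d' : mx2 a b c d *m mx2 a' b' c' d' =
  mx2 (a * a' + b * c') (a * b' + b * d') (c * a' + d * c') (c * b' + d * d').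
Proof.
apply/matrixP => i j; rewrite !mxE !big_ord_recl big_ord0 !mxE /= addr0.
by case: (ord2P i) => ->; case: (ord2P j) => ->.
Qed.

Lemma mx2_col2 a b c d u v :
  mx2 a b c d *m col2 u v = col2 (a * u + b * v) (c * u + d * v).
Proof.
apply/matrixP => i j; rewrite !mxE !big_ord_recl big_ord0 !mxE /= addr0.
by case: (ord2P i) => ->.
Qed.

Lemma row2_mx2 u v a b c d :
  row2 u v *m mx2 a b c d = row2 (u * a + v * c) (u * b + v * d).
Proof.
apply/matrixP => i j; rewrite !mxE !big_ord_recl big_ord0 !mxE /= addr0.
by case: (ord2P j) => ->.
Qed.

Lemma col2_row2 u v u' v' :
  col2 u v *m row2 u' v' = mx2 (u * u') (u * v') (v * u') (v * v').
Proof.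
apply/matrixP => i j; rewrite !mxE !big_ord_recl big_ord0 !mxE /= addr0.
by case: (ord2P i) => ->; case: (ord2P j) => ->.
Qed.

Lemma row2_col2 u v u' v' : row2 u v *m col2 u' v' = (u * u' + v * v')%:M.
Proof.
apply/matrixP => i j; rewrite !mxE !big_ord_recl big_ord0 !mxE /= addr0.
by rewrite !ord1 eqxx mulr1n.
Qed.

Lemma col2_scalar u v x : col2 u v *m x%:M = col2 (u * x) (v * x).
Proof.
apply/matrixP => i j; rewrite !mxE !big_ord_recl big_ord0 !mxE /= addr0.
by rewrite !ord1 eqxx mulr1n; case: (ord2P i) => ->.
Qed.

Lemma scalar_row2 u v x : x%:M *m row2 u v = row2 (x * u) (x * v).
Proof.
by rewrite mul_scalar_mx; apply/matrixP => i j; rewrite !mxE; case: ifP.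
Qed.

Lemma scalar_mul1 x u : (x%:M : 'M_1) *m (u%:M : 'M_1) = (x * u)%:M.
Proof. by rewrite -scalar_mxM. Qed.

Lemma mx2_tr a b c d : (mx2 a b c d)^T = mx2 a c b d.
Proof.
by apply/matrixP => i j; rewrite !mxE; case: (ord2P i) => ->;
  case: (ord2P j) => ->.
Qed.

Lemma col2_tr u v : (col2 u v)^T = row2 u v.
Proof. by apply/matrixP => i j; rewrite !mxE. Qed.

Lemma row2_tr u v : (row2 u v)^T = col2 u v.
Proof. by apply/matrixP => i j; rewrite !mxE. Qed.

Lemma mx2_opp a b c d : - mx2 a b c d = mx2 (- a) (- b) (- c) (- d).
Proof. by apply/matrixP => i j; rewrite !mxE; do 2!case: ifP. Qed.

Lemma row2_opp u v : - row2 u v = row2 (- u) (- v).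
Proof. by apply/matrixP => i j; rewrite !mxE; case: ifP. Qed.

Lemma mx2_add a b c d a' b' c' d' : mx2 a b c d + mx2 a' b' c' d' =
  mx2 (a + a') (b + b') (c + c') (d + d').
Proof. by apply/matrixP => i j; rewrite !mxE; do 2!case: ifP. Qed.

Lemma col2_add u v u' v' : col2 u v + col2 u' v' = col2 (u + u') (v + v').
Proof. by apply/matrixP => i j; rewrite !mxE; case: ifP. Qed.

Lemma row2_add u v u' v' : row2 u v + row2 u' v' = row2 (u + u') (v + v').
Proof. by apply/matrixP => i j; rewrite !mxE; case: ifP. Qed.

Lemma mx2_1 : 1%:M = mx2 1 0 0 1.
Proof.
by apply/matrixP => i j; rewrite !mxE; case: (ord2P i) => ->;
  case: (ord2P j) => ->.
Qed.

Lemma scalar_mx_inj1 x u : x%:M = u%:M :> 'M[R]_1 -> x = u.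
Proof. by move=> /matrixP /(_ 0 0); rewrite !mxE eqxx !mulr1n. Qed.

Lemma mx1E (D : 'M[R]_1) : D = (D 0 0)%:M.
Proof. by apply/matrixP => i j; rewrite !mxE !ord1 eqxx mulr1n. Qed.

(** The determinants of size one and two, over a ring that need not be
    commutative. *)
Lemma det_mx1 x : \det (x%:M : 'M[R]_1) = x.
Proof.
rewrite /determinant (bigD1 (1%g : 'S_1)) //= [X in _ + X]big_pred0; last first.
  by move=> s; apply/negbTE; rewrite negbK; apply/eqP/permP => i; rewrite !ord1.
by rewrite odd_perm1 expr0 mul1r addr0 big_ord_recl big_ord0 mulr1 perm1 mxE
  eqxx mulr1n.
Qed.

Lemma det_mx2 a b c d : \det (mx2 a b c d) = a * d - b * c.
Proof.
have ne : (0 : 'I_2) != 1 by [].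
have t1 : tperm 0 1 != 1%g :> {perm 'I_2}.
  by apply/eqP => /permP /(_ 0); rewrite tpermL perm1 => /eqP.
rewrite /determinant (bigD1 (1%g : 'S_2)) //= (bigD1 (tperm 0 1)) //=.
rewrite [X in _ + (_ + X)]big_pred0 => [|s].
  rewrite odd_perm1 odd_tperm ne expr0 expr1 mul1r addr0 mulN1r.
  rewrite !big_ord_recl !big_ord0 !mulr1 !perm1.
  have -> : lift ord0 ord0 = 1 :> 'I_2 by apply: val_inj.
  have -> : ord0 = 0 :> 'I_2 by apply: val_inj.
  by rewrite tpermL tpermR !mxE.
apply/negbTE; rewrite negb_and !negbK.
have s01 := inj_eq (@perm_inj _ s) 0 1.
(* A permutation of two elements is determined by the image of 0. *)
case: (ord2P (s 0)) => s0; [apply/orP; left | apply/orP; right];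
  apply/eqP/permP => i; rewrite ?perm1; move: s01; rewrite s0;
  case: (ord2P (s 1)) => s1; rewrite ?s1 ?eqxx // => _;
  by case: (ord2P i) => ->; rewrite ?tpermL ?tpermR.
Qed.

End SmallMatrices.

Section MapSmallMatrices.
Variables (R S : pzRingType) (f : R -> S).

Lemma map_mx2 a b c d : map_mx f (mx2 a b c d) = mx2 (f a) (f b) (f c) (f d).
Proof. by apply/matrixP => i j; rewrite !mxE; do 2!case: ifP. Qed.

Lemma map_col2 u v : map_mx f (col2 u v) = col2 (f u) (f v).
Proof. by apply/matrixP => i j; rewrite !mxE; case: ifP. Qed.

Lemma map_row2 u v : map_mx f (row2 u v) = row2 (f u) (f v).
Proof. by apply/matrixP => i j; rewrite !mxE; case: ifP. Qed.

End MapSmallMatrices.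

(** * Points of SpO(2|1) *)

Section Odd.
Variables (K : fieldType) (A : comSuperalgType K).
Hypothesis charK : 2%N \notin [pchar K].
Implicit Types (x y : A) (u : even_part A).

Lemma even_central u x : x * val u = val u * x.
Proof.
have hu := even_val_parity u.
have [y [z [hy hz ->]]] := parity_sum x; rewrite mulrDl mulrDr.
by rewrite (supermulC _ _ _ _ hy hu) (supermulC _ _ _ _ hz hu) !mul1r.
Qed.

Lemma odd_anticomm x y : of_parity true x -> of_parity true y ->
  x * y = - (y * x).
Proof. by move=> hx hy; rewrite (supermulC _ _ _ _ hx hy) expr1 mulN1r. Qed.

Lemma odd_sqr x : of_parity true x -> x * x = 0.
Proof.
move=> hx; have n2 : (2%:R : K) != 0 by apply: contra charK => n2; rewrite inE.
have e : (x * x) *+ 2 = 0 by rewrite mulr2n {1}(odd_anticomm hx hx) addNr.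
rewrite -[x * x]mul1r -(rmorph1 (kscal : {rmorphism K -> A})) -(mulVf n2).
by rewrite rmorphM rmorph_nat -mulrA mulr_natl e mulr0.
Qed.

Lemma odd_mul_even x y : of_parity true x -> of_parity true y ->
  x * y \in even A.
Proof. by move=> hx hy; apply/evenP; exact: (@of_parityM _ _ true true). Qed.

End Odd.

(** A point: the six entries that determine a matrix of SpO(2|1)(A), namely the
    upper left block and the upper right column, with their relation. *)
Record point (K : fieldType) (A : superalgType K) := Point {
  pt_a : even_part A;
  pt_b : even_part A;
  pt_c : even_part A;
  pt_d : even_part A;
  pt_al : A;
  pt_be : A;
  pt_al_odd : of_parity true pt_al;
  pt_be_odd : of_parity true pt_be;
  pt_rel : val pt_a * val pt_d = 1 + val pt_b * val pt_c + pt_al * pt_be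
}.

Section PointTheory.
Variables (K : fieldType) (A : comSuperalgType K).
Hypothesis charK : 2%N \notin [pchar K].
Variables al be : A.
Hypotheses (hal : of_parity true al) (hbe : of_parity true be).
Local Notation E := (even_part A).
Implicit Types u v w x y z : E.

(** The even element [al * be], of square zero. *)
Definition pt_eps : E := EvenPart (odd_mul_even hal hbe).
Local Notation eps := pt_eps.

Lemma pt_eps_sqr : eps * eps = 0.
Proof.
apply: val_inj; rewrite rmorphM /= mulrA -[al * be * al]mulrA.
by rewrite (odd_anticomm hbe hal) mulrN mulrA odd_sqr // mul0r oppr0 mul0r.
Qed.

(** The odd element [x * al + y * be].  Every odd entry of the matrices below has
    this form, and products of two such elements are multiples of [eps]
    ([lin_mul]); this moves all computations to the commutative even part. *)
Definition lin x y : A := val x * al + val y * be.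

Lemma lin_odd x y : of_parity true (lin x y).
Proof.
have hx := even_val_parity x; have hy := even_val_parity y.
by apply: of_parityD; apply: (@of_parityM _ _ false true).
Qed.

Lemma lin10 : lin 1 0 = al.
Proof. by rewrite /lin rmorph1 rmorph0 mul1r mul0r addr0. Qed.

Lemma lin01 : lin 0 1 = be.
Proof. by rewrite /lin rmorph1 rmorph0 mul1r mul0r add0r. Qed.

Lemma linZ u x y : val u * lin x y = lin (u * x) (u * y).
Proof. by rewrite /lin mulrDr !mulrA !rmorphM. Qed.

Lemma linZr u x y : lin x y * val u = lin (u * x) (u * y).
Proof. by rewrite even_central linZ. Qed.

Lemma lin_al u : al * val u = lin u 0.
Proof. by rewrite -lin10 linZr mulr1 mulr0. Qed.

Lemma lin_be u : be * val u = lin 0 u.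
Proof. by rewrite -lin01 linZr mulr1 mulr0. Qed.

Lemma val_al u : val u * al = lin u 0.
Proof. by rewrite -even_central lin_al. Qed.

Lemma val_be u : val u * be = lin 0 u.
Proof. by rewrite -even_central lin_be. Qed.

Lemma linD x y z w : lin x y + lin z w = lin (x + z) (y + w).
Proof. by rewrite /lin !rmorphD !mulrDl addrACA. Qed.

Lemma linN x y : - lin x y = lin (- x) (- y).
Proof. by rewrite /lin !rmorphN !mulNr opprD. Qed.

Lemma lin_eps x y x' y' : x = eps * x' -> y = eps * y' -> lin x y = 0.
Proof.
move=> -> ->; rewrite (mulrC eps x') (mulrC eps y') /lin !rmorphM -!mulrA.
rewrite (odd_anticomm hbe hal) mulrN [al * (al * be)]mulrA !odd_sqr //.
by rewrite mul0r oppr0 !mulr0 addr0.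
Qed.

Lemma lin_mul x y z w : lin x y * lin z w = val ((x * w - y * z) * eps).
Proof.
have swap (s t : A) u v : val u * s * (val v * t) = val (u * v) * (s * t).
  by rewrite -[_ * s * _]mulrA [s * _]mulrA even_central !mulrA rmorphM.
rewrite /lin mulrDl !mulrDr !swap !odd_sqr // !mulr0 add0r addr0.
rewrite (odd_anticomm hbe hal) mulrN.
by rewrite [in RHS]rmorphM [in RHS]rmorphB mulrBl.
Qed.

Lemma val_lin_mul u x y v z w :
  (val u + lin x y) * (val v + lin z w) =
  val (u * v + (x * w - y * z) * eps) + lin (u * z + v * x) (u * w + v * y).
Proof.
rewrite mulrDl (mulrDr (val u)) (mulrDr (lin x y)) linZ linZr lin_mul -linD.
rewrite [in RHS]rmorphD [in RHS]rmorphM.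
by rewrite [X in _ + X]addrC addrACA.
Qed.

End PointTheory.

Section PointMatrix.
Variables (K : fieldType) (A : comSuperalgType K).
Hypothesis charK : 2%N \notin [pchar K].
Local Notation E := (even_part A).

Lemma J11E : J11 A = block_mx (mx2 0 1 (-1) 0) 0 0 (-1)%:M.
Proof.
apply/matrixP => i j; rewrite mxE; apply/esym.
case: (split_ordP i) => i' ->; case: (split_ordP j) => j' ->.
- rewrite block_mxEul mxE; by case: (ord2P i') => ->; case: (ord2P j') => ->.
- rewrite block_mxEur mxE !ord1; by case: (ord2P i') => ->.
- rewrite block_mxEdl mxE !ord1; by case: (ord2P j') => ->.
- by rewrite block_mxEdr mxE !ord1 eqxx mulr1n.
Qed.

(** The matrix of a point. *)
Definition point_mx (p : point A) : 'M[A]_(2 + 1) :=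
  let: a := val (pt_a p) in let: b := val (pt_b p) in
  let: c := val (pt_c p) in let: d := val (pt_d p) in
  let: al := pt_al p in let: be := pt_be p in
  block_mx (mx2 a b c d) (col2 al be)
    (row2 (a * be - c * al) (b * be - d * al)) (1 - al * be)%:M.

(** The form [M^st J M] over an arbitrary ring, computed blockwise. *)
Lemma symplectic_form_mxE (a b c d al be ga de e : A) :
  let M := block_mx (mx2 a b c d) (col2 al be) (row2 ga de) e%:M in
  supertranspose M *m J11 A *m M = block_mx
    (mx2 (- (c * a) + a * c - ga * ga) (- (c * b) + a * d - ga * de)
         (- (d * a) + b * c - de * ga) (- (d * b) + b * d - de * de))
    (col2 (- (c * al) + a * be - ga * e) (- (d * al) + b * be - de * e))
    (row2 (be * a - al * c - e * ga) (be * b - al * d - e * de))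
    (be * al - al * be - e * e)%:M.
Proof.
rewrite /= /supertranspose block_mxKul block_mxKur block_mxKdl block_mxKdr J11E.
rewrite mx2_tr col2_tr row2_tr row2_opp tr_scalar_mx !mulmx_block.
rewrite !mulmx0 !addr0 !add0r.
rewrite !(mx2_mul, row2_mx2, col2_row2, mx2_col2, row2_col2, col2_scalar,
  scalar_row2, scalar_mul1).
rewrite !(mulr0, mul0r, mulr1, mul1r, mulrN1, mulrN, mulNr, add0r, addr0).
rewrite !opprK.
by rewrite !(mx2_add, row2_add, col2_add) -raddfD.
Qed.

Lemma one_val : 1 = val (1 : E).
Proof. by rewrite rmorph1. Qed.

Lemma zero_val : 0 = val (0 : E).
Proof. by rewrite rmorph0. Qed.

(** The matrix of a point satisfies the equations of SpO(2|1). *)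
Lemma point_mx_in (p : point A) : in_SpO21 (point_mx p).
Proof.
rewrite /point_mx; move: (pt_al_odd p) (pt_be_odd p) (pt_rel p).
move: (pt_a p) (pt_b p) (pt_c p) (pt_d p) (pt_al p) (pt_be p).
move=> a b c d al be hal hbe rel.
set eps := pt_eps hal hbe.
have relE : a * d = 1 + b * c + eps.
  by apply: val_inj; rewrite !rmorphD !rmorphM rmorph1.
have eps2 : eps * eps = 0 := pt_eps_sqr charK hal hbe.
have eE : 1 - al * be = val (1 - eps) by rewrite rmorphB rmorph1.
have gaE : val a * be - val c * al = lin al be (- c) a.
  by rewrite /lin rmorphN mulNr addrC.
have deE : val b * be - val d * al = lin al be (- d) b.
  by rewrite /lin rmorphN mulNr addrC.
rewrite eE gaE deE.
split.
- rewrite /supermatrix block_mxKul block_mxKur block_mxKdl block_mxKdr.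
  split=> i j; rewrite mxE.
  + by do 2!case: ifP => _; exact: even_val_parity.
  + by case: ifP.
  + by case: ifP => _; apply: lin_odd.
  + by rewrite !ord1 mulr1n; exact: even_val_parity.
(* The upper left block has determinant [1 + eps], of inverse [1 - eps]. *)
- exists (mx2 (val ((1 - eps) * d)) (val ((1 - eps) * - b))
    (val ((1 - eps) * - c)) (val ((1 - eps) * a))), (val (1 + eps))%:M.
  rewrite block_mxKul block_mxKur block_mxKdl block_mxKdr; split.
  + by split=> [i j||];
    [by rewrite mxE; do 2!case: ifP => _; exact: even_val_parity |..];
      rewrite mx2_mul mx2_1 -!rmorphM -!rmorphD; congr mx2;
      rewrite ?one_val ?zero_val; congr (val _);
      ring: relE eps2.
  + by split=> [i j||];
    [by rewrite !ord1 mxE mulr1n; exact: even_val_parity |..];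
      rewrite scalar_mul1 -rmorphM; congr _%:M; rewrite one_val;
      congr (val _); ring: eps2.
  + rewrite col2_scalar col2_row2 mx2_opp mx2_add det_mx2 det_mx1.
    rewrite !(lin_al al be, lin_be al be) !lin_mul // -/eps one_val.
    rewrite -!(rmorphN, rmorphD, rmorphM).
    by congr (val _); ring: relE eps2.
- rewrite symplectic_form_mxE J11E.
  rewrite !(lin_al al be, lin_be al be, val_al al be, val_be al be).
  rewrite !(linZ, linZr).
  rewrite !(linN, linD) !lin_mul // -/eps (odd_anticomm hbe hal).
  rewrite -[al * be]/(val eps) -!(rmorphN, rmorphD, rmorphM).
  congr block_mx.
  + by rewrite zero_val one_val -!rmorphN; congr mx2;
      congr (val _); ring: relE eps2.
  + rewrite (@lin_eps _ _ charK _ _ hal hbe _ _ (- c) a) -/eps; [|ring..].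
    rewrite (@lin_eps _ _ charK _ _ hal hbe _ _ (- d) b) -/eps; [|ring..].
    by apply/matrixP => i j; rewrite !mxE; case: ifP.
  + rewrite (@lin_eps _ _ charK _ _ hal hbe _ _ (- c) a) -/eps; [|ring..].
    rewrite (@lin_eps _ _ charK _ _ hal hbe _ _ (- d) b) -/eps; [|ring..].
    by apply/matrixP => i j; rewrite !mxE; case: ifP.
  + by rewrite one_val -rmorphN; congr _%:M; congr (val _); ring: eps2.
Qed.

(** The equations of SpO(2|1) give the relation of a point and determine the
    last row by the first two.  Here [e'] is the inverse of the lower right entry [e]. *)
Lemma symplectic_group_relations (a b c d e e' : E) (al be ga de : A)
    (hal : of_parity true al) (hbe : of_parity true be)
    (eps := pt_eps hal hbe) :
    let M := block_mx (mx2 (val a) (val b) (val c) (val d)) (col2 al be)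
               (row2 ga de) (val e)%:M in
    supertranspose M *m J11 A *m M = J11 A ->
    e * e' = 1 ->
    \det (ulsubmx M - ursubmx M *m (val e')%:M *m dlsubmx M) * val e' = 1 ->
  [/\ a * d = 1 + b * c + eps, e = 1 - eps, ga = lin al be (- c) a
    & de = lin al be (- d) b].
Proof.
move=> M; rewrite {1}/M symplectic_form_mxE J11E.
have eps2 : eps * eps = 0 := pt_eps_sqr charK hal hbe.
move=> /eq_block_mx [/mx2_inj [_ h1 _ _] hc _ h4] ee'.
(* The relations of the last column give [ga] and [de] in terms of [e']. *)
have {hc} [h2 h3] : ga * val e = val a * be - val c * al /\
    de * val e = val b * be - val d * al.
  move: hc => /matrixP hc; have := hc 0 0; have := hc 1 0; rewrite !mxE /=.
  by move=> /subr0_eq h3 /subr0_eq h2; rewrite -h2 -h3 !(addrC (- _)).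
have gaE : ga = lin al be (- (e' * c)) (e' * a).
  rewrite -[ga]mulr1 (one_val : (1 : A) = _) -ee' rmorphM mulrA h2.
  by rewrite (val_be al be) (val_al al be) linN linD linZr; congr lin; ring.
have deE : de = lin al be (- (e' * d)) (e' * b).
  rewrite -[de]mulr1 (one_val : (1 : A) = _) -ee' rmorphM mulrA h3.
  by rewrite (val_be al be) (val_al al be) linN linD linZr; congr lin; ring.
rewrite /M block_mxKul block_mxKur block_mxKdl.
rewrite col2_scalar col2_row2 mx2_opp mx2_add det_mx2.
move: h1 h4; rewrite gaE deE !(lin_al al be, lin_be al be) !lin_mul // -/eps.
rewrite (odd_anticomm hbe hal) -[al * be]/(val eps) one_val.
rewrite -!(rmorphN, rmorphD, rmorphM) => /val_inj h1
  /scalar_mx_inj1 /val_inj h4.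
move=> /val_inj h5.
have {}h4 : e * e + eps + eps = 1.
  by rewrite -[1]opprK -h4; ring.
(* As [e ^ 2 = 1 - 2 * eps], the factor [e' ^ 2] is absorbed by [eps]. *)
have e'2 : e' * e' * eps = eps.
  rewrite -[LHS]mul1r -[X in X * _]h4.
  transitivity ((e * e') * (e * e') * eps + (e' * e' + e' * e') * (eps * eps)).
    by ring.
  by rewrite ee' eps2 !mul1r mulr0 addr0.
have {}h1 : (a * d - b * c) * (1 - eps) = 1.
  transitivity ((a * d - b * c) * (1 - e' * e' * eps)); first by rewrite e'2.
  by rewrite -[RHS]h1; ring.
have hD : a * d - b * c = 1 + eps.
  transitivity ((a * d - b * c) * (1 - eps) * (1 + eps)).
    by ring: eps2.
  by rewrite h1 mul1r.
(* The superdeterminant is [(a * d - b * c) * (1 - eps) ^ 2 * e']. *)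
have {}h5 : (1 - eps) * e' = 1.
  transitivity
    ((a * d - b * c) * (1 - e' * e' * eps) * (1 - e' * e' * eps) * e').
    by rewrite e'2 h1 mul1r.
  by rewrite -[RHS]h5; ring.
have eE : e = 1 - eps.
  transitivity ((1 - eps) * e' * e); first by rewrite h5 mul1r.
  by rewrite -mulrA (mulrC e') ee' mulr1.
have e'E : e' = 1 + eps.
  transitivity ((1 + eps) * ((1 - eps) * e')); last by rewrite h5 mulr1.
  transitivity (e' - eps * eps * e'); [by rewrite eps2 mul0r subr0 | by ring].
have lin_eps1 x y : lin al be (e' * x) (e' * y) = lin al be x y.
  rewrite -[RHS]addr0 -(@lin_eps _ _ charK _ _ hal hbe _ _ x y erefl erefl).
  by rewrite -/eps linD e'E; congr lin; ring.
split=> //; first by rewrite addrAC -hD; ring.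
- by rewrite -[RHS]lin_eps1; congr lin; ring.
- by rewrite -[RHS]lin_eps1; congr lin; ring.
Qed.

(** Every matrix of SpO(2|1)(A) is the matrix of a point. *)
Lemma point_of_mx (M : 'M[A]_(2 + 1)) : in_SpO21 M ->
  exists p : point A, M = point_mx p.
Proof.
case=> [[hP hB hC hD] [P' [D' [_ [hD' eD _] hs]]]].
have ev m n (N : 'M[A]_(m, n)) i j : parity_mx false N ->
    exists u : E, N i j = val u.
  move=> hN; have /evenP h := hN i j.
  by exists (EvenPart h).
have [a Ea] := ev _ _ _ 0 0 hP; have [b Eb] := ev _ _ _ 0 1 hP.
have [c Ec] := ev _ _ _ 1 0 hP; have [d Ed] := ev _ _ _ 1 1 hP.
have [e Ee] := ev _ _ _ 0 0 hD; have [e' Ee'] := ev _ _ _ 0 0 hD'.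
have MP := mx2E (ulsubmx M); have MB := col2E (ursubmx M).
have MC := row2E (dlsubmx M); have MD := mx1E (drsubmx M).
have MD' := mx1E D'; rewrite Ea Eb Ec Ed in MP; rewrite Ee in MD.
rewrite Ee' in MD'; have al_odd := hB 0 0; have be_odd := hB 1 0.
move: MB MC al_odd be_odd.
move: (ursubmx M 0 0) (ursubmx M 1 0) (dlsubmx M 0 0) (dlsubmx M 0 1).
move=> al be ga de MB MC al_odd be_odd.
have ee' : e * e' = 1.
  move: eD; rewrite MD MD' scalar_mul1 => /scalar_mx_inj1.
  by rewrite -rmorphM one_val => /val_inj.
rewrite MD' det_mx1 in hs.
have EM : M = block_mx (mx2 (val a) (val b) (val c) (val d)) (col2 al be)
    (row2 ga de) (val e)%:M by rewrite -MP -MB -MC -MD submxK.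
rewrite EM => hJ; rewrite EM in hs.
have [rel eE gaE deE] :=
  symplectic_group_relations al_odd be_odd hJ ee' (esym hs).
have rel' : val a * val d = 1 + val b * val c + al * be.
  by rewrite -rmorphM rel !rmorphD rmorph1 rmorphM.
exists (Point al_odd be_odd rel'); rewrite /point_mx.
rewrite eE gaE deE rmorphB rmorph1 /lin !rmorphN !mulNr.
by rewrite !(addrC (- _)).
Qed.

End PointMatrix.

(** * Polynomials vanishing at a fraction *)

Lemma linear_poly_eval (R : idomainType) (F : fieldType)
    (io : {rmorphism R -> F}) (x c : R) (t : F) :
  (map_poly io (x *: 'X - c%:P)).[t] = io x * t - io c.
Proof. by rewrite rmorphB /= map_polyZ map_polyX map_polyC !hornerE. Qed.

Lemma linear_poly_deriv_eval (R : idomainType) (F : fieldType)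
    (io : {rmorphism R -> F}) (x c : R) (t : F) :
  (map_poly io (x *: 'X - c%:P)^`()).[t] = io x.
Proof.
by rewrite derivB derivC derivZ derivX subr0 alg_polyC map_polyC hornerC.
Qed.

Section FractionRoot.
(* The kernel of [sg] is generated by [x], so that [x] is a prime element; it
   does not divide [c]. *)
Variables (R S : idomainType) (x c : R) (sg : {rmorphism R -> S}).
Hypotheses (sgx : sg x = 0) (sgc : sg c != 0).
Hypothesis ker_sg : forall r, sg r = 0 -> exists t, r = x * t.
Hypothesis x_neq0 : x != 0.

Let w : {poly R} := x *: 'X - c%:P.

Lemma poly_ker_sg (p : {poly R}) : map_poly sg p = 0 -> exists q, p = x *: q.
Proof.
elim/poly_ind: p => [|p r IH] h; first by exists 0; rewrite scaler0.
have {}h : map_poly sg p * 'X + (sg r)%:P = 0.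
  by move: h; rewrite rmorphD rmorphM /= map_polyX map_polyC.
have r0 : sg r = 0.
  have := congr1 (fun q : {poly S} => q`_0) h.
  by rewrite coefD coefMX coefC add0r coef0.
have p0 : map_poly sg p = 0.
  by move: h; rewrite r0 addr0 => /eqP; rewrite mulf_eq0 polyX_eq0 orbF => /eqP.
have [q ->] := IH p0; have [t ->] := ker_sg r0.
exists (q * 'X + t%:P).
by rewrite scalerDr scalerAl -mul_polyC -[x *: _%:P]mul_polyC polyCM.
Qed.

(** Modulo [x] the polynomial [w = x 'X - c] is a nonzero constant, so that [x]
    can be cancelled from a multiple of [w]. *)
Lemma dvd_linear_cancel (p q : {poly R}) k : x ^+ k *: p = q * w ->
  exists h, p = h * w.
Proof.
elim: k p q => [|k IH] p q; first by rewrite scale1r; exists q.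
rewrite exprS -scalerA => e.
have : map_poly sg q * (- (sg c)%:P) = 0.
  have := congr1 (map_poly sg) e; rewrite rmorphM /= map_polyZ sgx scale0r.
  by rewrite rmorphB /= map_polyZ sgx scale0r sub0r map_polyC.
move/eqP; rewrite mulf_eq0 oppr_eq0 polyC_eq0 (negbTE sgc) orbF => /eqP.
move=> /poly_ker_sg [q' e']; apply: (IH p q').
move: e; rewrite e' -scalerAl => /eqP; rewrite -subr_eq0 -scalerBr.
by rewrite -mul_polyC mulf_eq0 polyC_eq0 (negbTE x_neq0) subr_eq0 => /eqP.
Qed.

(** A polynomial that vanishes at the fraction [t = c / x] is a multiple of
    [x 'X - c]: pseudo-division shows it for a multiple by a power of [x]. *)
Lemma fraction_root (F : fieldType) (io : {rmorphism R -> F}) (t : F) :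
  injective io -> io x * t = io c ->
  forall p, (map_poly io p).[t] = 0 -> exists h, p = h * w.
Proof.
move=> io_inj hxt p hp.
have lw : lead_coef w = x.
  rewrite lead_coefDl ?lead_coefZ ?lead_coefX ?mulr1 //.
  rewrite size_polyN size_scale // size_polyX.
  exact: leq_ltn_trans (size_polyC_leq1 _) _.
have w_neq0 : w != 0 by rewrite -lead_coef_eq0 lw.
have sw : size w = 2.
  rewrite size_polyDl ?size_scale ?size_polyX //.
  by rewrite size_polyN (leq_ltn_trans (size_polyC_leq1 _)).
have := Pdiv.Idomain.divp_eq p w; rewrite lw => e.
have sr : (size (p %% w)%R <= 1)%N.
  by have := Pdiv.Idomain.ltn_modp p w; rewrite w_neq0 sw.
have [r rE] : exists r, p %% w = r%:P.
  by exists ((p %% w)`_0); exact: size1_polyC.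
have r0 : r = 0.
  apply: io_inj; rewrite rmorph0.
  have := congr1 (fun q : {poly R} => (map_poly io q).[t]) e.
  rewrite rE /= map_polyZ hornerZ hp mulr0 rmorphD rmorphM /= map_polyC.
  by rewrite hornerD hornerM hornerC linear_poly_eval hxt subrr mulr0 add0r.
by move: e; rewrite rE r0 addr0 => /dvd_linear_cancel.
Qed.

End FractionRoot.

Section MPolyZero.
Variables (K : fieldType) (n : nat) (i : 'I_n).
(** Substitution of 0 for the variable ['X_i]. *)
Definition mpoly_zero : {mpoly K[n]} -> {mpoly K[n]} :=
  mmap (@mpolyC n K) (fun j => if j == i then 0 else 'X_j).
HB.instance Definition _ := GRing.RMorphism.on mpoly_zero.

Lemma mpoly_zeroX j : mpoly_zero 'X_j = if j == i then 0 else 'X_j.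
Proof. by rewrite /mpoly_zero mmapX mmap1U. Qed.

Lemma mpoly_zeroC a : mpoly_zero a%:MP = a%:MP.
Proof. by rewrite /mpoly_zero mmapC. Qed.

Lemma mpoly_zeroB p : exists t, p - mpoly_zero p = 'X_i * t.
Proof.
pose P (p : {mpoly K[n]}) := exists t, p - mpoly_zero p = 'X_i * t.
have PM q r : P q -> P r -> P (q * r).
  move=> [t et] [u eu]; exists (t * r + mpoly_zero q * u).
  by rewrite rmorphM mulrDr mulrA -et mulrCA -eu; ring.
have PC a : P a%:MP by exists 0; rewrite mpoly_zeroC subrr mulr0.
have PX j : P 'X_j.
  rewrite /P mpoly_zeroX; case: eqP => [->|_].
    by exists 1; rewrite subr0 mulr1.
  by exists 0; rewrite subrr mulr0.
rewrite -/(P p); elim/mpolyind: p => [|a m p _ _ [t et]].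
  by exists 0; rewrite rmorph0 subrr mulr0.
have [u eu] : P (a *: 'X_[m]).
  rewrite -mul_mpolyC; apply: (PM) => //; rewrite mpolyXE_id.
  apply: (big_ind P) => [||j _]; [by rewrite -mpolyC1 | exact: PM |].
  by elim: (m j) => [|k IH]; rewrite ?expr0 -?mpolyC1 // exprS; apply: PM.
by exists (u + t); rewrite rmorphD mulrDr -et -eu; ring.
Qed.

End MPolyZero.

(** * Evaluation of polynomials at a point *)

(** Polynomials in the four even coordinates of a point: ['X_0], ['X_1] and
    ['X_ord_max] stand for [a], [b] and [c], and the outer variable ['X] for [d].
    Separating [d] makes Euclidean division by [a * d - (1 + b * c)] available. *)
Notation coord_poly K := {poly {mpoly K[3]}}.

Section Evaluation.
Variables (K : fieldType) (A : comSuperalgType K).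
Local Notation E := (even_part A).
Local Notation P := (coord_poly K).

(** The scalars, as a morphism to the even part. *)
Definition even_scal (k : K) : E :=
  EvenPart (introT (@evenP K A _) (even_kscal A k)).

Lemma even_scal_zmod : zmod_morphism even_scal.
Proof. by move=> x y; apply: val_inj; rewrite [RHS]rmorphB /= rmorphB. Qed.

Lemma even_scal_monoid : monoid_morphism even_scal.
Proof.
split=> [|x y]; apply: val_inj; first by rewrite [RHS]rmorph1 /= rmorph1.
by rewrite [RHS]rmorphM /= rmorphM.
Qed.

HB.instance Definition _ := GRing.isZmodMorphism.Build K E even_scal
  even_scal_zmod.
HB.instance Definition _ := GRing.isMonoidMorphism.Build K E even_scal
  even_scal_monoid.

(** The morphism [g] substitutes the coordinates of the point [p]. *)
Definition evaluates (p : point A) (g : P -> E) :=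
  [/\ g 'X = pt_d p, g ('X_0)%:P = pt_a p, g ('X_1)%:P = pt_b p,
      g ('X_ord_max)%:P = pt_c p & forall k, val (g (k%:MP)%:P) = kscal k].

Lemma evaluation_exists (p : point A) :
  exists g : {rmorphism P -> E}, evaluates p g.
Proof.
(* The evaluation morphisms of polynomials require a nontrivial target; over
   the zero ring the zero map serves. *)
have [e0|ne0] := eqVneq (1 : E) 0.
  have all0 (u : E) : u = 0 by rewrite -[u]mul1r e0 mul0r.
  have gz : zmod_morphism (fun _ : P => 0 : E) by move=> x y; rewrite subr0.
  have gm : monoid_morphism (fun _ : P => 0 : E).
    by split=> [|x y]; rewrite ?mul0r ?e0.
  pose gA := GRing.isZmodMorphism.Build P E _ gz.
  pose gM := GRing.isMonoidMorphism.Build P E _ gm.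
  exists (HB.pack_for {rmorphism P -> E} (fun _ : P => 0 : E) gA gM).
  split=> [||||k]; try exact/esym/all0.
  by rewrite -[kscal k]/(val (even_scal k)) [even_scal k]all0.
pose E' : comNzRingType := HB.pack E (GRing.PzSemiRing_isNonZero.Build E ne0).
pose x : 'I_3 -> E' :=
  fun i => if i == 0 then pt_a p else if i == 1 then pt_b p else pt_c p.
pose f : {rmorphism K -> E'} := (even_scal : {rmorphism K -> E}).
pose g3 : {rmorphism {mpoly K[3]} -> E'} := mmap f x.
pose g : {rmorphism P -> E'} := horner_eval (pt_d p : E') \o map_poly g3.
exists g; split => [||||k]; rewrite /g /= /horner_eval.
- by rewrite map_polyX hornerX.
- by rewrite map_polyC hornerC /= mmapX mmap1U.
- by rewrite map_polyC hornerC /= mmapX mmap1U.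
- by rewrite map_polyC hornerC /= mmapX mmap1U.
- by rewrite map_polyC hornerC /= mmapC.
Qed.

End Evaluation.

Section SuperEvaluation.
Variable K : fieldType.
Local Notation P := (coord_poly K).

(** The evaluation of polynomials at a point. *)
Definition evaluation (A : comSuperalgType K) (p : point A) :
  {rmorphism P -> even_part A} := sval (cid (evaluation_exists p)).

Lemma evaluationP (A : comSuperalgType K) (p : point A) :
  evaluates p (evaluation p).
Proof. exact: (svalP (cid (evaluation_exists p))). Qed.

(** Superpolynomials in all six coordinates: [(f1, f2, f3, f4)] stands for
    [f1 + f2 * al + f3 * be + f4 * (al * be)]. *)
Definition superpoly : zmodType := (P * P * P * P)%type.

(** The product of superpolynomials; the sign comes from
    [be * al = - (al * be)]. *)
Definition superpoly_mul (F G : superpoly) : superpoly :=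
  let: (f1, f2, f3, f4) := F in let: (g1, g2, g3, g4) := G in
  (f1 * g1, f1 * g2 + f2 * g1, f1 * g3 + f3 * g1,
   f1 * g4 + f4 * g1 + f2 * g3 - f3 * g2).

Section At.
Variables (A : comSuperalgType K) (p : point A).
Local Notation al := (pt_al p).
Local Notation be := (pt_be p).
Local Notation ev f := (val (evaluation p f)).

(** The evaluation of superpolynomials at a point. *)
Definition supereval (F : superpoly) : A :=
  let: (f1, f2, f3, f4) := F in
  ev f1 + ev f2 * al + ev f3 * be + ev f4 * (al * be).

Lemma superevalD F G : supereval (F + G) = supereval F + supereval G.
Proof.
case: F G => [[[f1 f2] f3] f4] [[[g1 g2] g3] g4]; rewrite /supereval /=.
rewrite !rmorphD !mulrDl [RHS]addrACA; congr (_ + _).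
by rewrite [RHS]addrACA; congr (_ + _); rewrite [RHS]addrACA.
Qed.

Lemma superevalN F : supereval (- F) = - supereval F.
Proof.
case: F => [[[f1 f2] f3] f4]; rewrite /supereval /=.
by rewrite !rmorphN !mulNr !opprD.
Qed.

Hypothesis charK : 2%N \notin [pchar K].

Lemma superevalE f1 f2 f3 f4 : supereval (f1, f2, f3, f4) =
  val (evaluation p f1 + evaluation p f4 * pt_eps (pt_al_odd p) (pt_be_odd p))
  + lin al be (evaluation p f2) (evaluation p f3).
Proof.
by rewrite /supereval /lin rmorphD rmorphM addrA -!(addrAC _ (_ * (al * be))).
Qed.

(** Evaluation is multiplicative: at every point the terms in [eps * al] and
    [eps * be] vanish. *)
Lemma superevalM F G :
  supereval (superpoly_mul F G) = supereval F * supereval G.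
Proof.
case: F G => [[[f1 f2] f3] f4] [[[g1 g2] g3] g4]; rewrite /superpoly_mul.
rewrite !superevalE.
rewrite !(rmorphD (evaluation p), rmorphN (evaluation p)).
rewrite !(rmorphM (evaluation p)).
have eps2 := pt_eps_sqr charK (pt_al_odd p) (pt_be_odd p).
rewrite (val_lin_mul charK (pt_al_odd p) (pt_be_odd p)); move: eps2.
set eps := pt_eps _ _.
move: (evaluation p f1) (evaluation p f2) (evaluation p f3) (evaluation p f4).
move=> u1 u2 u3 u4.
move: (evaluation p g1) (evaluation p g2) (evaluation p g3) (evaluation p g4).
move=> v1 v2 v3 v4 eps2; congr (_ + _); first by congr (val _); ring: eps2.
rewrite -[LHS]addr0.
have <- := @lin_eps _ _ charK _ _ (pt_al_odd p) (pt_be_odd p) _ _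
  (u4 * v2 + v4 * u2) (u4 * v3 + v4 * u3) erefl erefl.
by rewrite linD -/eps; congr lin; ring.
Qed.

End At.
End SuperEvaluation.

(** * The Grassmann algebra on two odd variables *)

Lemma gmonomM (F : fieldType) n (S T : {set 'I_n}) :
  (gmonom F S : grassmann F n) * gmonom F T = gsign F S T *: gmonom F (S :|: T).
Proof.
apply/ffunP => U; rewrite [LHS]gmulE [RHS]ffunE (bigD1 S) //=.
rewrite [X in _ + X]big1 ?addr0 => [|S' /negbTE nS]; last first.
  by rewrite big1 // => T' _; rewrite ffunE nS mulr0 mul0r.
rewrite big_mkcond (bigD1 T) //= [X in _ + X]big1 ?addr0
    => [|T' /negbTE nT]; last first.
  by rewrite [gmonom F T _]ffunE nT mulr0; case: ifP.
rewrite !ffunE !eqxx !mulr1 eq_sym /GRing.scale /=.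
by case: eqP => _; rewrite ?mulr1 ?mulr0.
Qed.

Section GrassmannTwo.
Variable F : fieldType.
Local Notation G := (grassmann F 2).

(** The odd variables [y_0] and [y_1]. *)
Definition gvar (i : 'I_2) : G := gmonom F [set i].
Local Notation y0 := (gvar 0).
Local Notation y1 := (gvar 1).

Lemma gvar_sqr i : gvar i * gvar i = 0.
Proof.
by rewrite gmonomM /gsign -setI_eq0 setIid -cards_eq0 cards1 scale0r.
Qed.

Lemma gvar_odd i : gparity true (gvar i).
Proof.
by move=> S; rewrite ffunE; have [->|//] := eqVneq S [set i]; rewrite cards1.
Qed.

Lemma gvarC i j : gvar i * gvar j = - (gvar j * gvar i).
Proof.
by rewrite (gmul_supercomm (@gvar_odd i) (@gvar_odd j)) expr1 mulN1r.
Qed.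

Lemma gvar01_neq0 : y0 * y1 != 0.
Proof.
rewrite gmonomM /gsign -setI_eq0.
have -> : [set 0] :&: [set 1] = set0 :> {set 'I_2}.
  by apply/setP => i; rewrite !inE; case: (ord2P i) => ->.
rewrite eqxx scaler_eq0 signr_eq0 /=; apply/eqP => /ffunP /(_ [set 0; 1]) /eqP.
by rewrite !ffunE eqxx oner_eq0.
Qed.

Lemma gvar01_sqr : (y0 * y1) * (y0 * y1) = 0.
Proof.
by rewrite {2}gvarC mulrN mulrA -(mulrA y0) gvar_sqr mulr0 mul0r oppr0.
Qed.

Lemma grassmann2_free (f1 f2 f3 f4 : F) :
  f1%:A + f2 *: y0 + f3 *: y1 + f4 *: (y0 * y1) = 0 ->
  [/\ f1 = 0, f2 = 0, f3 = 0 & f4 = 0].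
Proof.
have Z (f : F) : f *: (y0 * y1) = 0 -> f = 0.
  by move=> /eqP; rewrite scaler_eq0 (negbTE gvar01_neq0) orbF => /eqP.
move=> h.
have y0Y : y0 * (y0 * y1) = 0 by rewrite mulrA gvar_sqr mul0r.
have y1Y : y1 * (y0 * y1) = 0.
  by rewrite (gvarC 0 1) mulrN mulrA gvar_sqr mul0r oppr0.
have f10 : f1 = 0.
  apply: Z; have := congr1 (fun z : G => z * (y0 * y1)) h.
  by rewrite mul0r !mulrDl -!scalerAl mul1r y0Y y1Y gvar01_sqr !scaler0 !addr0.
have f20 : f2 = 0.
  apply: Z; have := congr1 (fun z : G => z * y1) h.
  rewrite mul0r f10 scale0r add0r !mulrDl -!scalerAl -mulrA !gvar_sqr.
  by rewrite mulr0 !scaler0 !addr0.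
have f30 : f3 = 0.
  apply: Z; have := congr1 (fun z : G => y0 * z) h.
  rewrite mulr0 f10 f20 !scale0r !add0r mulrDr -!scalerAr mulrA gvar_sqr.
  by rewrite mul0r scaler0 addr0.
by split=> //; apply: Z; rewrite -h f10 f20 f30 !scale0r !add0r.
Qed.

(** The coefficients, on the basis [1], [y_0], [y_1], [y_0 * y_1], of a vanishing
    combination whose coefficients [f + u * Y] involve [Y = y_0 * y_1]: only the
    nilpotent part [u1] contributes, since [Y * y_0 = Y * y_1 = Y * Y = 0]. *)
Lemma grassmann2_nilpotent_free (f1 f2 f3 f4 u1 u2 u3 u4 : F) (Y := y0 * y1) :
  (f1%:A + u1 *: Y) + (f2%:A + u2 *: Y) * y0 + (f3%:A + u3 *: Y) * y1
    + (f4%:A + u4 *: Y) * Y = 0 ->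
  [/\ f1 = 0, f2 = 0, f3 = 0 & f4 + u1 = 0].
Proof.
have Y0 : Y * y0 = 0 by rewrite /Y gvarC mulNr -mulrA gvar_sqr mulr0 oppr0.
have Y1 : Y * y1 = 0 by rewrite -mulrA gvar_sqr mulr0.
rewrite !mulrDl -!scalerAl !mul1r Y0 Y1 gvar01_sqr !scaler0 !addr0 => h.
apply: grassmann2_free; rewrite -[RHS]h scalerDl [_ + u1 *: _]addrC.
by rewrite addrA -!(addrAC _ (u1 *: Y)).
Qed.

(** Taylor expansion of order one, exact because [y_0 * y_1] has square zero. *)
Lemma taylor_grassmann2 (R : idomainType) (io : {rmorphism R -> F})
    (h : {rmorphism {poly R} -> G}) (t u : F) :
    (forall r, h r%:P = (io r)%:A) -> h 'X = t%:A + u *: (y0 * y1) ->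
  forall f, h f = ((map_poly io f).[t])%:A
                + ((map_poly io f^`()).[t] * u) *: (y0 * y1).
Proof.
move=> hC hX; elim/poly_ind => [|f c IH].
  by rewrite deriv0 !rmorph0 !horner0 mul0r !scale0r addr0.
rewrite rmorphD rmorphM hX hC IH.
rewrite derivD derivM derivC derivX mulr1 addr0 !rmorphD !rmorphM /=.
rewrite map_polyX map_polyC !hornerE mulrDl !mulrDr.
rewrite -!(scalerAl, scalerAr) mul1r gvar01_sqr !scaler0 addr0 !scalerA !mulr1.
rewrite mul1r scalerDl mulrDl scalerDl (mulrAC _ u t) -!addrA; congr (_ + _).
by rewrite addrA addrC [X in _ + X]addrC.
Qed.

Lemma scalar_mpoly_hom n (K : fieldType) (io : {rmorphism {mpoly K[n]} -> F})
    (h : {rmorphism {mpoly K[n]} -> G}) :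
    (forall i, h 'X_i = (io 'X_i)%:A) -> (forall k, h k%:MP = (io k%:MP)%:A) ->
  forall f, h f = (io f)%:A.
Proof.
move=> hX hC; elim/mpolyind => [|k m f _ _ IH].
  by rewrite !rmorph0 scale0r.
rewrite !rmorphD IH scalerDl; congr (_ + _).
rewrite -mul_mpolyC !rmorphM hC -scalerA mulr_algl; congr (_ *: _).
rewrite mpolyXE_id !rmorph_prod -[RHS]/(in_alg G _) rmorph_prod.
by apply: eq_bigr => i _; rewrite !rmorphXn hX.
Qed.

(** The value of [(1 + b * c + y_0 * y_1) / a]. *)
Definition exchange_d (a b c : F) : G :=
  ((1 + b * c) / a)%:A + a^-1 *: (y0 * y1).

Lemma exchange_rel (a b c : F) : a != 0 ->
  a%:A * exchange_d a b c = 1 + b%:A * c%:A + y0 * y1.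
Proof.
move=> a0; rewrite /exchange_d mulr_algl scalerDr !scalerA.
rewrite [a * (_ / _)]mulrC mulfVK //.
by rewrite mulfV // scale1r mulr_algl scalerA scalerDl scale1r.
Qed.

Lemma scalar_unit (a : F) : a != 0 -> (a%:A : G) \is a GRing.unit.
Proof.
move=> a0; apply/unitrP; exists (a^-1%:A).
by rewrite !mulr_algl !scalerA mulVf // mulfV // scale1r.
Qed.

(** The exchange relation read in both directions: from [a] to [d], and from [d]
    to [a]. *)
Lemma exchange_d_of_a (a b c : F) : a != 0 ->
  (a%:A)^-1 * (1 + b%:A * c%:A + y0 * y1) = exchange_d a b c.
Proof. by move=> a0; rewrite -(exchange_rel b c a0) mulKr // scalar_unit. Qed.

Lemma exchange_a_of_d (a b c : F) : a != 0 ->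
  exchange_d a b c \is a GRing.unit ->
  (exchange_d a b c)^-1 * (1 + b%:A * c%:A + y0 * y1) = a%:A.
Proof.
by move=> a0 du; rewrite -(exchange_rel b c a0) mulr_algl -mulr_algr mulKr.
Qed.

End GrassmannTwo.

(** * The superquiver and its mutations *)

(** The superquiver with arrows [x_1 -> x_0], [x_2 -> x_0], [y_0 -> x_0] and
    [x_0 -> y_1], in which only [x_0] is mutable. *)
Definition SpO_quiver : quiver 3 2 := Quiver
  (fun u v : vertex 3 2 => match u, v with
    | inl i, inl j => nat_of_bool ((i != 0) && (j == 0))
    | inr i, inl k => nat_of_bool ((i == 0) && (k == 0))
    | inl k, inr j => nat_of_bool ((k == 0) && (j == 1))
    | inr _, inr _ => 0%N
    end)
  (fun v => v == inl 0).

Lemma SpO_superquiver : superquiver SpO_quiver.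
Proof.
split=> /=.
- by move=> k; rewrite andNb.
- move=> k l _; case: (eqVneq k 0) => _ /=; first by left.
  by case: (eqVneq l 0) => _ /=; [right | left].
- by left.
- move=> i j k _ k0 _ _ _; left=> l /= l0.
  have e (u : 'I_3) : (inl u == inl 0 :> vertex 3 2) = (u == 0) by [].
  by move: k0 l0; rewrite /mutable /= !e => /eqP -> /eqP ->.
Qed.

Lemma ord3P (i : 'I_3) : [\/ i = 0, i = 1 | i = ord_max].
Proof.
case: i => [[|[|[|//]]] ?]; [apply: Or31 | apply: Or32 | apply: Or33];
  exact: val_inj.
Qed.

(** The mutated superquiver: the arrows at [x_0] from even vertices are reversed. *)
Definition SpO_quiver_rev := even_quiver_mutation 0 SpO_quiver.

Lemma SpO_quiver_revK : even_quiver_mutation 0 SpO_quiver_rev = SpO_quiver.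
Proof.
rewrite /SpO_quiver_rev /even_quiver_mutation /SpO_quiver /=.
congr Quiver; apply/funext => u; apply/funext => v.
case: u v => [i|i] [j|j] //=.
by case: (ord3P i) => ->; case: (ord3P j) => ->.
Qed.

Lemma even_mutation_involutive (K : fieldType) m n k (s : seed K m n) :
    even_exchange k (even_mutation k s) = evar s k ->
    even_quiver_mutation k (even_quiver_mutation k (squiver s)) = squiver s ->
  even_mutation k (even_mutation k s) = s.
Proof.
move=> he hq; rewrite {1}/even_mutation he [squiver _]/= hq.
case: s {he hq} => e o q; congr Seed; apply/funext => l /=.
by case: (eqVneq l k) => [->|].
Qed.

Section Exchange.
Variable K : fieldType.
Local Notation G := (ambient K 3 2).

(** Both superquivers give the same exchange polynomial; there are no loops, hence
    no signs. *)
Lemma SpO_even_exchange (s : seed K 3 2) :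
  squiver s = SpO_quiver \/ squiver s = SpO_quiver_rev ->
  even_exchange 0 s =
    (evar s 0)^-1 * (1 + evar s 1 * evar s ord_max + ovar s 0 * ovar s 1).
Proof.
have l1 i : loops_near SpO_quiver i = 0%N.
  by rewrite /loops_near big1 // => j _; rewrite muln0.
have l2 i : loops_near SpO_quiver_rev i = 0%N.
  by rewrite /loops_near big1 // => j _; rewrite muln0.
have e01 : lift ord0 ord0 = 1 :> 'I_3 by apply: val_inj.
have e02 : lift ord0 (lift ord0 ord0) = ord_max :> 'I_3 by apply: val_inj.
have e00 : ord0 = 0 :> 'I_3 by apply: val_inj.
have f00 : ord0 = 0 :> 'I_2 by apply: val_inj.
have f01 : lift ord0 ord0 = 1 :> 'I_2 by apply: val_inj.
rewrite /even_exchange; case=> ->; congr (_ * _); congr (_ + _).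
1,3: rewrite !(big_ord_recl, big_ord0) /= ?e00 ?e01 ?e02.
1,2: rewrite ?l1 ?l2 ?muln0 /=.
1,2: by rewrite ?addn0 !expr0 ?expr1 !mulr1 !mul1r 1?addrC.
all: under eq_bigr => i _ do rewrite big_mkcond /=.
all: rewrite !(big_ord_recl, big_ord0) /= ?f00 ?f01 /=.
all: by rewrite ?mulr0n ?mulr1n ?add0r ?addr0.
Qed.

Local Notation L := {fraction {mpoly K[3]}}.

(** The even variable [x_i], in the field of rational functions. *)
Definition xvar (i : 'I_3) : L := tofrac ('X_i : {mpoly K[3]}).

Lemma xvar_neq0 i : xvar i != 0.
Proof. by rewrite /xvar tofrac_eq0 -msize_poly_eq0 msizeX. Qed.

(** The new even variable [d], in the ambient algebra. *)
Definition amb_d : G := exchange_d (xvar 0) (xvar 1) (xvar ord_max).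

Local Notation s0 := (initial_seed K SpO_quiver).

Lemma evar_mutation_neq (s : seed K 3 2) k l :
  l != k -> evar (even_mutation k s) l = evar s l.
Proof. by move=> /negbTE h; rewrite /= h. Qed.

Lemma SpO_exchange0 : even_exchange 0 s0 = amb_d.
Proof.
rewrite SpO_even_exchange; last by left.
exact: exchange_d_of_a (xvar_neq0 0).
Qed.

(** Even mutations yield only the initial seed and its mutation at [x_0]. *)
Lemma SpO_even_reachable s : even_reachable s0 s ->
  s = s0 \/ s = even_mutation 0 s0.
Proof.
elim=> [|t k _ IH]; first by left.
have k0 : mutable (squiver t) (inl k) -> k = 0.
  have e (u : 'I_3) : (inl u == inl 0 :> vertex 3 2) = (u == 0) by [].
  by case: IH => -> /=; rewrite e => /eqP.
move=> /k0 ->; case: IH => ->; first by right.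
move=> du; left.
have E : even_exchange 0 (even_mutation 0 s0) = evar s0 0.
  rewrite SpO_even_exchange; last by right.
  move: du; rewrite /= SpO_exchange0.
  exact: exchange_a_of_d (xvar_neq0 0).
exact: even_mutation_involutive E SpO_quiver_revK.
Qed.

(** There is no odd mutation, since the odd vertices are frozen. *)
Lemma SpO_odd_reachable s : odd_reachable s0 s -> s = s0.
Proof. by elim=> // t i _ ->. Qed.

End Exchange.

(** * The universal point *)

Section Universal.
Variable K : fieldType.
Local Notation G := (ambient K 3 2).
Local Notation C := (cluster_superalgebra K SpO_quiver).
Local Notation s0 := (initial_seed K SpO_quiver).
Local Notation xvar := (xvar K).

Lemma evar_s0 i : evar s0 i = (xvar i)%:A. Proof. by []. Qed.
Lemma ovar_s0 i : ovar s0 i = gvar _ i. Proof. by []. Qed.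

Lemma cluster_even_x i : cluster_even SpO_quiver ((xvar i)%:A : G).
Proof. by exists s0, i; split; first exact: even_reachable0. Qed.

Lemma cluster_even_d : cluster_even SpO_quiver (amb_d K).
Proof.
exists (even_mutation 0 s0), 0; split; last exact: esym (SpO_exchange0 K).
apply: even_reachableS => //; first exact: even_reachable0.
exact: scalar_unit (xvar_neq0 K 0).
Qed.

Lemma cluster_odd_y i : cluster_odd SpO_quiver (gvar _ i : G).
Proof. by exists s0, i; split; first exact: odd_reachable0. Qed.

Lemma cluster_even_of_parity (z : C) : cluster_even SpO_quiver (val z) ->
  z \in even C.
Proof. by move=> h; apply/evenP; exact: cluster_even_parity h. Qed.

Lemma in_cluster_even (z : G) : cluster_even SpO_quiver z ->
  z \in in_cluster K SpO_quiver.
Proof. by move=> h; apply/in_clusterP; exact: generated_even. Qed.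

Lemma in_cluster_odd (z : G) : cluster_odd SpO_quiver z ->
  z \in in_cluster K SpO_quiver.
Proof. by move=> h; apply/in_clusterP; exact: generated_odd. Qed.

(** An even cluster variable, in the even part of the cluster superalgebra. *)
Definition cl_even (z : G) (h : cluster_even SpO_quiver z) : even_part C :=
  @EvenPart K C (Cluster (in_cluster_even h))
    (@cluster_even_of_parity (Cluster (in_cluster_even h)) h).

(** The odd variable [y_i], in the cluster superalgebra. *)
Definition cl_odd (i : 'I_2) : C := Cluster (in_cluster_odd (cluster_odd_y i)).

Lemma cl_odd_parity i : of_parity true (cl_odd i).
Proof. exact: cluster_odd_parity (cluster_odd_y i). Qed.

Lemma cl_rel : val (cl_even (cluster_even_x 0)) * val (cl_even cluster_even_d) =
  1 + val (cl_even (cluster_even_x 1)) * val (cl_even (cluster_even_x ord_max))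
  + cl_odd 0 * cl_odd 1.
Proof. apply: val_inj; exact: exchange_rel (xvar_neq0 K 0). Qed.

(** The universal point, with coordinates the cluster variables. *)
Definition universal_point : point C :=
  Point (cl_odd_parity 0) (cl_odd_parity 1) cl_rel.

Local Notation U := universal_point.

(** The cluster superalgebra is generated by the coordinates of the universal
    point. *)
Lemma cluster_ind (Pr : C -> Prop) :
    Pr (val (pt_a U)) -> Pr (val (pt_b U)) -> Pr (val (pt_c U)) ->
    Pr (val (pt_d U)) -> Pr (pt_al U) -> Pr (pt_be U) ->
    (forall k : K, Pr (kscal k)) ->
    (forall z t, Pr z -> Pr t -> Pr (z + t)) ->
    (forall z t, Pr z -> Pr t -> Pr (z * t)) ->
  forall z, Pr z.
Proof.
move=> ha hb hc hd hal hbe hk hD hM.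
have irr (z t : C) : val z = val t -> Pr t -> Pr z by move=> /val_inj ->.
have hx i : forall z : C, val z = (xvar i)%:A -> Pr z.
  by case: (ord3P i) => -> z e; [apply: irr ha | apply: irr hb | apply: irr hc].
suff h (g : G) : cluster_generated SpO_quiver g ->
    forall z : C, val z = g -> Pr z.
  by move=> z; apply: (h (val z)) => //; apply/in_clusterP; exact: valP.
elim=> {g}.
- move=> g [s [k [/SpO_even_reachable hs ->]]] z.
  case: hs => ->; first by rewrite evar_s0; exact: hx.
  have [->|k0] := eqVneq k 0; last by rewrite evar_mutation_neq //; exact: hx.
  by rewrite [evar _ _]SpO_exchange0 => e; apply: irr hd; exact: e.
- move=> g [s [i [/SpO_odd_reachable -> ->]]] z.
  rewrite ovar_s0.
  by case: (ord2P i) => -> e; [apply: irr hal | apply: irr hbe].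
- by move=> k z e; apply: irr (hk k).
- move=> g1 g2 /in_clusterP h1 IH1 /in_clusterP h2 IH2 z e.
  apply: (irr _ (Cluster h1 + Cluster h2)) => //.
  by apply: hD; [apply: IH1 | apply: IH2].
- move=> g1 g2 /in_clusterP h1 IH1 /in_clusterP h2 IH2 z e.
  apply: (irr _ (Cluster h1 * Cluster h2)) => //.
  by apply: hM; [apply: IH1 | apply: IH2].
Qed.

End Universal.

(** * Relations between the generators *)

Section Presentation.
Variable K : fieldType.
Hypothesis charK : 2%N \notin [pchar K].
Local Notation G := (ambient K 3 2).
Local Notation C := (cluster_superalgebra K SpO_quiver).
Local Notation L := {fraction {mpoly K[3]}}.
Local Notation P := (coord_poly K).
Local Notation U := (universal_point K).
Local Notation xvar := (xvar K).

(** Evaluation at the universal point, with values in the ambient algebra. *)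
Definition amb_eval : {rmorphism P -> G} :=
  (val : C -> G) \o ((val : even_part C -> C) \o evaluation U).

(** The value of [d] modulo the odd variables. *)
Definition frac_d : L := (1 + xvar 1 * xvar ord_max) / xvar 0.

Lemma amb_evalE f : amb_eval f =
  ((map_poly (@tofrac _) f).[frac_d])%:A
  + ((map_poly (@tofrac _) f^`()).[frac_d] / xvar 0) *: (gvar _ 0 * gvar _ 1).
Proof.
have [hd ha hb hc hk] := evaluationP U.
apply: taylor_grassmann2; last by rewrite /amb_eval /= hd.
apply: (scalar_mpoly_hom (h := amb_eval \o polyC)) => [i|k] /=.
  by case: (ord3P i) => ->; rewrite ?ha ?hb ?hc.
by rewrite hk.
Qed.

(** The polynomial [a * d - (1 + b * c)]. *)
Definition rel_poly : P := 'X_0 *: 'X - (1 + 'X_1 * 'X_ord_max)%:P.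

Lemma frac_dE : xvar 0 * frac_d = tofrac (1 + 'X_1 * 'X_ord_max : {mpoly K[3]}).
Proof.
by rewrite /frac_d mulrC mulfVK ?xvar_neq0 // rmorphD rmorphM rmorph1.
Qed.

Lemma rel_poly_root : (map_poly (@tofrac _) rel_poly).[frac_d] = 0.
Proof.
apply: etrans (linear_poly_eval _ _ _ _) _.
by apply/eqP; rewrite subr_eq0; apply/eqP/frac_dE.
Qed.

Lemma rel_poly_deriv : (map_poly (@tofrac _) rel_poly^`()).[frac_d] = xvar 0.
Proof. exact: linear_poly_deriv_eval. Qed.

Lemma frac_d_root (f : P) : (map_poly (@tofrac _) f).[frac_d] = 0 ->
  exists g, f = g * rel_poly.
Proof.
apply: (fraction_root (sg := mpoly_zero 0)) => //.
- by rewrite /= mpoly_zeroX.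
(* [1 + 'X_1 * 'X_ord_max] is not divisible by ['X_0]: its value at 0 is 1. *)
- rewrite rmorphD rmorphM rmorph1 /= !mpoly_zeroX /=.
  apply/eqP => /(congr1 (meval (fun=> 0))); rewrite !rmorphD rmorphM rmorph1 /=.
  by rewrite !mevalXU mulr0 addr0 rmorph0 => /eqP; rewrite oner_eq0.
- move=> r r0; have [t rE] := mpoly_zeroB 0 r; exists t; rewrite -rE.
  by rewrite [mpoly_zero 0 r]r0 subr0.
- by rewrite -msize_poly_eq0 msizeX.
- by move=> x y /eqP; rewrite /= tofrac_eq => /eqP.
- exact: frac_dE.
Qed.

Lemma supereval_amb f1 f2 f3 f4 : val (supereval U (f1, f2, f3, f4)) =
  amb_eval f1 + amb_eval f2 * gvar _ 0 + amb_eval f3 * gvar _ 1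
  + amb_eval f4 * (gvar _ 0 * gvar _ 1).
Proof.
rewrite /supereval 3!(rmorphD (val : C -> G)).
rewrite !(rmorphM (val : C -> G)).
congr (_ + _ * _ + _ * _ + _ * (_ * _)).
Qed.

(** A superpolynomial that vanishes at the universal point vanishes at every
    point: the coordinates of the universal point satisfy no relation besides
    [pt_rel]. *)
Lemma supereval_kernel (F : superpoly K) : supereval U F = 0 ->
  forall (A : comSuperalgType K) (p : point A), supereval p F = 0.
Proof.
case: F => [[[f1 f2] f3] f4] /(congr1 (val : C -> G)).
rewrite supereval_amb !amb_evalE.
move=> /grassmann2_nilpotent_free [/frac_d_root [g1 e1]].
move=> /frac_d_root [g2 e2] /frac_d_root [g3 e3] h4.
(* The derivative of [g1 * rel_poly] at [frac_d] is [g1(frac_d) * xvar 0]. *)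
have {h4} /frac_d_root [g4 e4] : (map_poly (@tofrac _) (f4 + g1)).[frac_d] = 0.
  rewrite -h4 rmorphD hornerD e1; congr (_ + _).
  rewrite derivM rmorphD !rmorphM hornerD !hornerM rel_poly_root mulr0 add0r.
  by rewrite rel_poly_deriv mulfK ?xvar_neq0.
have {}e4 : f4 = g4 * rel_poly - g1 by rewrite -e4 addrK.
move=> A p; rewrite superevalE //.
set eps := pt_eps _ _.
have ew : evaluation p rel_poly = eps.
  have [hd ha hb hc hk] := evaluationP p.
  rewrite /rel_poly -mul_polyC rmorphB rmorphM hd ha polyCD polyCM.
  rewrite rmorphD rmorphM hb hc polyC1 rmorph1.
  apply: val_inj; rewrite rmorphB rmorphD !rmorphM rmorph1.
  by rewrite pt_rel addrC addKr.
have eps2 : eps * eps = 0 := pt_eps_sqr charK _ _.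
rewrite e1 e2 e3 e4 rmorphB !rmorphM ew.
rewrite (@lin_eps _ _ charK _ _ (pt_al_odd p) (pt_be_odd p) _ _
  (evaluation p g2) (evaluation p g3)) -/eps; [|exact: mulrC..].
by rewrite mulrBl -mulrA eps2 mulr0 sub0r addrN rmorph0 addr0.
Qed.

End Presentation.

(** * Morphisms out of the cluster superalgebra *)

Section SuperevalBasics.
Variables (K : fieldType) (A : comSuperalgType K) (p : point A).
Local Notation P := (coord_poly K).

Lemma supereval_const (f : P) : supereval p (f, 0, 0, 0) = val (evaluation p f).
Proof. by rewrite /supereval !rmorph0 !mul0r !addr0. Qed.

Lemma supereval_al : supereval p (0, 1, 0, 0) = pt_al p.
Proof. by rewrite /supereval !rmorph0 !mul0r !rmorph1 mul1r !addr0 add0r. Qed.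

Lemma supereval_be : supereval p (0, 0, 1, 0) = pt_be p.
Proof. by rewrite /supereval !rmorph0 !mul0r !rmorph1 mul1r !addr0 add0r. Qed.

(** The homogeneous component of parity [b]. *)
Definition superpoly_part (b : bool) (F : superpoly K) : superpoly K :=
  let: (f1, f2, f3, f4) := F in
  if b then (0, f2, f3, 0) else (f1, 0, 0, f4).

Lemma superpoly_partE F : F = superpoly_part false F + superpoly_part true F.
Proof.
by case: F => [[[f1 f2] f3] f4]; congr (_, _, _, _); rewrite ?addr0 ?add0r.
Qed.

Lemma superpoly_part_parity b F :
  of_parity b (supereval p (superpoly_part b F)).
Proof.
case: F => [[[f1 f2] f3] f4]; case: b; rewrite superevalE.
  rewrite !rmorph0 mul0r addr0 rmorph0 add0r.
  exact: lin_odd (pt_al_odd p) (pt_be_odd p) _ _.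
by rewrite !rmorph0 /lin rmorph0 !mul0r !addr0; exact: even_val_parity.
Qed.

End SuperevalBasics.

Section Extension.
Variable K : fieldType.
Hypothesis charK : 2%N \notin [pchar K].
Local Notation C := (cluster_superalgebra K SpO_quiver).
Local Notation U := (universal_point K).

Lemma supereval_surj (z : C) : exists F, supereval U F = z.
Proof.
have [hd ha hb hc hk] := evaluationP U.
elim/cluster_ind: z => [||||||k|z t [F <-] [H <-]|z t [F <-] [H <-]].
- by exists (('X_0)%:P, 0, 0, 0); rewrite supereval_const ha.
- by exists (('X_1)%:P, 0, 0, 0); rewrite supereval_const hb.
- by exists (('X_ord_max)%:P, 0, 0, 0); rewrite supereval_const hc.
- by exists ('X, 0, 0, 0); rewrite supereval_const hd.
- by exists (0, 1, 0, 0); rewrite supereval_al.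
- by exists (0, 0, 1, 0); rewrite supereval_be.
- by exists ((k%:MP)%:P, 0, 0, 0); rewrite supereval_const hk.
- by exists (F + H); rewrite superevalD.
- by exists (superpoly_mul F H); rewrite superevalM.
Qed.

Section At.
Variables (A : comSuperalgType K) (p : point A).

(** The map that sends the value of a superpolynomial at the universal point to
    its value at [p].  A superpolynomial with the given value is chosen;
    [extendE] shows that the choice is immaterial. *)
Definition extend (z : C) : A := supereval p (sval (cid (supereval_surj z))).

Lemma extendE F : extend (supereval U F) = supereval p F.
Proof.
rewrite /extend; case: cid => H /= e; apply/eqP; rewrite -subr_eq0.
rewrite -superevalN -superevalD; apply/eqP; apply: supereval_kernel => //.
by rewrite superevalD superevalN e subrr.
Qed.

Lemma extend_zmod : zmod_morphism extend.
Proof.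
move=> z t; have [F <-] := supereval_surj z; have [H <-] := supereval_surj t.
by rewrite -superevalN -superevalD !extendE superevalD superevalN.
Qed.

Lemma extend_scal k : extend (kscal k) = kscal k.
Proof.
have [_ _ _ _ hU] := evaluationP U; have [_ _ _ _ hp] := evaluationP p.
by rewrite -hU -supereval_const extendE supereval_const hp.
Qed.

Lemma extend_monoid : monoid_morphism extend.
Proof.
split=> [|z t].
  by rewrite -(rmorph1 (kscal : {rmorphism K -> C})) extend_scal rmorph1.
have [F <-] := supereval_surj z; have [H <-] := supereval_surj t.
by rewrite -superevalM // !extendE superevalM.
Qed.

Lemma extend_parity b z : of_parity b z -> of_parity b (extend z).
Proof.
have [F <-] := supereval_surj z; rewrite {1}(superpoly_partE F) superevalD.
suff h : of_parity b (supereval U F) ->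
    supereval U F = supereval U (superpoly_part b F).
  rewrite -superevalD -superpoly_partE => /h ->; rewrite extendE.
  exact: superpoly_part_parity.
rewrite {1 2}(superpoly_partE F) superevalD.
have h0 := superpoly_part_parity U false F.
have h1 := superpoly_part_parity U true F.
have cancel c (u v : C) : of_parity c u -> of_parity (~~ c) v ->
    of_parity c (u + v) -> u + v = u.
  move=> hu hv huv; have hv' : of_parity c v.
    by rewrite -[v](addKr u); apply: of_parityD => //; exact: of_parityN.
  have -> : v = 0; last by rewrite addr0.
  by case: c hv hv' {hu huv} => hv hv'; exact: parity_cap.
case: b => hb; last exact: (cancel false).
by rewrite addrC; apply: (cancel true) => //; rewrite addrC.
Qed.

Lemma extend_evaluation f :
  extend (val (evaluation U f)) = val (evaluation p f).
Proof. by rewrite -(supereval_const U) extendE supereval_const. Qed.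

Lemma extend_al : extend (pt_al U) = pt_al p.
Proof. by rewrite -(supereval_al U) extendE supereval_al. Qed.

Lemma extend_be : extend (pt_be U) = pt_be p.
Proof. by rewrite -(supereval_be U) extendE supereval_be. Qed.

HB.instance Definition _ := GRing.isZmodMorphism.Build C A extend extend_zmod.
HB.instance Definition _ := GRing.isMonoidMorphism.Build C A extend
  extend_monoid.
HB.instance Definition _ :=
  isSuperalgMorphism.Build K C A extend extend_scal extend_parity.

(** The morphism that sends the universal point to [p]. *)
Definition extension : superhom C A := extend.

End At.

End Extension.

Section Comp.
Variables (K : fieldType) (A B C : superalgType K).
Variables (g : superhom B C) (f : superhom A B).
Lemma superhom_comp_scal a : (g \o f) (kscal a) = kscal a.
Proof. by rewrite /= !kscal_map. Qed.
Lemma superhom_comp_parity b x : of_parity b x -> of_parity b ((g \o f) x).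
Proof. by move=> h; do 2!apply: parity_map. Qed.
HB.instance Definition _ :=
  isSuperalgMorphism.Build K A C (g \o f) superhom_comp_scal
    superhom_comp_parity.
End Comp.

Section MapPoint.
Variables (K : fieldType) (A B : comSuperalgType K) (f : superhom A B).

Lemma map_point_mx (p : point A) :
  map_mx f (point_mx p) =
  block_mx (mx2 (f (val (pt_a p))) (f (val (pt_b p))) (f (val (pt_c p)))
      (f (val (pt_d p)))) (col2 (f (pt_al p)) (f (pt_be p)))
    (row2 (f (val (pt_a p)) * f (pt_be p) - f (val (pt_c p)) * f (pt_al p))
      (f (val (pt_b p)) * f (pt_be p) - f (val (pt_d p)) * f (pt_al p)))
    (1 - f (pt_al p) * f (pt_be p))%:M.
Proof.
rewrite /point_mx map_block_mx map_mx2 map_col2 map_row2 map_scalar_mx.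
by rewrite !(rmorphB f) !(rmorphM f) rmorph1.
Qed.

Lemma map_point_mx_eq (p : point A) (q : point B) :
    f (val (pt_a p)) = val (pt_a q) -> f (val (pt_b p)) = val (pt_b q) ->
    f (val (pt_c p)) = val (pt_c q) -> f (val (pt_d p)) = val (pt_d q) ->
    f (pt_al p) = pt_al q -> f (pt_be p) = pt_be q ->
  map_mx f (point_mx p) = point_mx q.
Proof.
by move=> ha hb hc hd hal hbe; rewrite map_point_mx ha hb hc hd hal hbe.
Qed.

End MapPoint.

Section Yoneda.
Variable K : fieldType.
Hypothesis charK : 2%N \notin [pchar K].
Local Notation C := (cluster_superalgebra K SpO_quiver).
Local Notation U := (universal_point K).

(** The universal element of SpO(2|1). *)
Definition universal_mx : SpO21 C := exist _ (point_mx U) (point_mx_in charK U).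

Lemma SpO21_eq (A : superalgType K) (M N : SpO21 A) : sval M = sval N -> M = N.
Proof.
case: M N => [M hM] [N hN] /= e; subst N.
by congr exist; exact: Prop_irrelevance.
Qed.

(** The universal matrix represents the functor SpO(2|1): every matrix is its
    image under a morphism, which is unique by [universal_mx_inj]. *)
Lemma universal_mx_surj (A : comSuperalgType K) (M : SpO21 A) :
  exists f : superhom C A, SpO21_map f universal_mx = M.
Proof.
have [p Mp] := point_of_mx charK (svalP M).
exists (extension charK p); apply: SpO21_eq; rewrite Mp /=.
have [hd ha hb hc _] := evaluationP U.
have [pd pa pb pc _] := evaluationP p.
have ev f : extension charK p (val (evaluation U f)) = val (evaluation p f).
  exact: extend_evaluation.
apply: map_point_mx_eq.
- by rewrite -ha ev pa.
- by rewrite -hb ev pb.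
- by rewrite -hc ev pc.
- by rewrite -hd ev pd.
- exact: extend_al.
- exact: extend_be.
Qed.

Lemma universal_mx_inj (A : comSuperalgType K) (f g : superhom C A) :
  SpO21_map f universal_mx = SpO21_map g universal_mx -> f = g.
Proof.
move=> /(congr1 (@sval _ _)) /=; rewrite !map_point_mx.
move=> /eq_block_mx [/mx2_inj [ha hb hc hd] /col2_inj [hal hbe] _ _].
apply: superhom_eq; elim/cluster_ind => // [k|z t hz ht|z t hz ht].
- by rewrite !kscal_map.
- by rewrite (rmorphD f) (rmorphD g); congr (_ + _).
- by rewrite (rmorphM f) (rmorphM g); congr (_ * _).
Qed.

End Yoneda.

Theorem theorem5p1 (K : fieldType) (charK : 2%N \notin [pchar K]) :
  exists (m n : nat) (Q : quiver m n), superquiver Q /\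
  exists Phi : forall A : comSuperalgType K,
      SpO21 A -> superhom (cluster_superalgebra K Q) A,
    (forall A : comSuperalgType K, bijective (Phi A)) /\
    (forall (A B : comSuperalgType K) (f : superhom A B) (M : SpO21 A)
        (z : cluster_superalgebra K Q),
      Phi B (SpO21_map f M) z = f (Phi A M z)).
Proof.
exists 3, 2, SpO_quiver; split; first exact: SpO_superquiver.
pose Phi (A : comSuperalgType K) (M : SpO21 A) :=
  sval (cid (universal_mx_surj charK M)).
have PhiK (A : comSuperalgType K) (M : SpO21 A) :
    SpO21_map (Phi A M) (universal_mx charK) = M.
  exact: svalP (cid (universal_mx_surj charK M)).
exists Phi; split=> [A|A B f M z].
  exists (fun f : superhom _ A => SpO21_map f (universal_mx charK)) => [M|f].
    exact: PhiK.
  by apply: universal_mx_inj; exact: PhiK.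
suff -> : Phi B (SpO21_map f M) = f \o Phi A M by [].
apply: universal_mx_inj; rewrite PhiK -{1}(PhiK A M).
by apply: SpO21_eq; rewrite /= -map_mx_comp.
Qed.
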